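(* Consider the $\beta$-model on $t$ vertices with parameter vector $\beta=(\beta_1,\ldots,\beta_t)^T\in\mathbb{R}^t$, let $\hat\beta$ be the maximum likelihood estimator of $\beta$, and let $L_t=\max_{1\le i\le t}|\beta_i|$. If $L_t=o\{\log(\log t)\}$ as $t\to\infty$, then for any fixed $r\ge 1$, as $t\to\infty$, the vector consisting of the first $r$ elements of $G_t^{1/2}(\hat\beta-\beta)$ is asymptotically standard multivariate normal (that is, it converges in distribution to $N(0,I_r)$, where $I_r$ is the $r\times r$ identity matrix), where $G_t=\mathrm{diag}(v_{1,1},\ldots,v_{t,t})$ and $G_t^{1/2}=\mathrm{diag}(v_{1,1}^{1/2},\ldots,v_{t,t}^{1/2})$.
   Context: The $\beta$-model: a random undirected simple graph on vertices $1,\ldots,t$ in which, for each pair $i\neq j$, an edge between $i$ and $j$ is present with probability $p_{i,j}=e^{\beta_i+\beta_j}/(1+e^{\beta_i+\beta_j})$, independently of all other edges. The parameter vector $\beta=(\beta_1,\ldots,\beta_t)^T\in\mathbb{R}^t$ may depend on $t$, and asymptotics are for $t\to\infty$. Let $d_i$ be the degree of vertex $i$. The likelihood is $e^{\sum_i\beta_i d_i}/\prod_{i<j}(1+e^{\beta_i+\beta_j})$, and the maximum likelihood estimator $\hat\beta=(\hat\beta_1,\ldots,\hat\beta_t)^T$ is the solution of the equations $$d_i=\sum_{j\neq i}\frac{e^{\hat\beta_i+\hat\beta_j}}{1+e^{\hat\beta_i+\hat\beta_j}},\qquad i=1,\ldots,t.$$ When $L_t=o(\log t)$ it is known (Chatterjee,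 Diaconis and Sly, 2011) that with probability tending to one as $t\to\infty$ a unique solution exists; on the event that no unique solution exists, $\hat\beta$ may be defined arbitrarily. The quantities $v_{i,j}$ are $$v_{i,j}=\frac{e^{\beta_i+\beta_j}}{(1+e^{\beta_i+\beta_j})^2}\ (i\neq j),\qquad v_{i,i}=\sum_{j\neq i}v_{i,j},$$ so that $V_t=(v_{i,j})_{t\times t}$ is the covariance matrix of $(d_1,\ldots,d_t)$ and the Fisher information matrix for $\beta$. *)

(* Defs.v *)
From HB Require Import structures.
From mathcomp Require Import all_boot all_order all_algebra.
From mathcomp Require Import all_classical all_reals all_analysis.

Set Implicit Arguments.
Unset Strict Implicit.
Unset Printing Implicit Defensive.

Import Order.TTheory GRing.Theory Num.Theory.
Import numFieldNormedType.Exports.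

Local Open Scope classical_set_scope.
Local Open Scope ring_scope.

Section std_normal.
Context {R : realType}.

Definition cons_pair n (x : (measurableTypeR R * n.-tuple R)%type) : n.+1.-tuple R :=
  [tuple of x.1 :: x.2].

Let measurable_cons_pair n : measurable_fun setT (@cons_pair n).
Proof. exact: measurable_cons. Qed.

HB.instance Definition _ n :=
  isMeasurableFun.Build _ _ _ _ (@cons_pair n) (@measurable_cons_pair n).

(* N(0, I_r), as the law of r independent N(0, 1) variables: the library has
   only binary product measures, so the r-fold product is built by recursion. *)
Fixpoint std_normal (r : nat) : probability (r.-tuple R) R :=
  match r return probability (r.-tuple R) R with
  | 0 => dirac [tuple]
  | n.+1 => distribution (normal_prob (0 : R) 1 \x std_normal n)%E
              (@cons_pair n)
  end.

Lemma std_normal_box r (A : 'I_r -> set R) : (forall i, measurable (A i)) ->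
  std_normal r [set y | forall i, A i (tnth y i)] =
  (\prod_(i < r) normal_prob (0 : R) 1 (A i))%E.
Proof.
elim: r A => [|r IHr] A mA.
  by rewrite big_ord0 /= diracE mem_set//=; case.
rewrite big_ord_recl /= -IHr//.
rewrite /distribution /pushforward.
rewrite [X in (_ \x _)%E X](_ : _ = A ord0 `*`
    [set y | forall i, A (lift ord0 i) (tnth y i)]).
  apply: product_measure1E; first exact: mA.
  rewrite (_ : [set y | _] = \bigcap_(i in [set: 'I_r])
      ((@tnth r R ^~ i) @^-1` A (lift ord0 i))).
    apply: fin_bigcap_measurable => // i _; rewrite -[X in measurable X]setTI.
    exact: measurable_tnth.
  by apply/seteqP; split => [y H i _|y H i]; [exact: H|exact: (H i)].
apply/seteqP; split => [[a y] /= H|[a y] /= [H0 H] i].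
  by split=> [|i]; [exact: (H ord0)|have := H (lift ord0 i); rewrite tnthS].
have [j ->|->] := unliftP ord0 i; last exact: H0.
by rewrite tnthS; exact: H.
Qed.

End std_normal.

(* Convergence in distribution of random vectors: the joint distribution
   functions converge at every continuity point of the limiting one. *)
Definition joint_cdf (R : realType) r (mu : set (r.-tuple R) -> \bar R)
    (x : 'rV[R]_r) : \bar R :=
  mu [set y | forall i, tnth y i <= x 0 i].

Definition cvg_in_distribution (R : realType) (d : nat -> measure_display)
    (T : forall n, measurableType (d n)) (P : forall n, probability (T n) R)
    r (X : forall n, T n -> r.-tuple R) (mu : probability (r.-tuple R) R) :=
  forall x : 'rV[R]_r, {for x, continuous (joint_cdf mu)} ->
    joint_cdf (pushforward (P n) (X n)) x @[n --> \oo] --> joint_cdf mu x.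

Definition mutually_independent (R : realType) d (T : measurableType d)
    (P : probability T R) (I : finType) (D : pred I) (E : I -> set T) :=
  forall J : {set I}, {subset J <= D} ->
    P (\bigcap_(i in [set` J]) E i) = (\prod_(i in J) P (E i))%E.

Section beta_model.
Context {R : realType} {t : nat}.
Implicit Types (b : 'cV[R]_t) (e : rel 'I_t) (i j : 'I_t).

Definition edge_prob b i j : R :=
  expR (b i 0 + b j 0) / (1 + expR (b i 0 + b j 0)).

Definition edge_var b i j : R :=
  expR (b i 0 + b j 0) / (1 + expR (b i 0 + b j 0)) ^+ 2.

Definition degree e i : nat := #|[pred j | e i j]|.

(* A graph is given by its adjacency relation; independence is required of
   unordered pairs, each represented once as (i, j) with i < j. *)
Definition beta_model d (T : measurableType d) (P : probability T R) b
    (adj : T -> rel 'I_t) : Prop :=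
  [/\ forall w, symmetric (adj w),
      forall w, irreflexive (adj w),
      forall i j, measurable [set w | adj w i j],
      forall i j, i != j -> P [set w | adj w i j] = (edge_prob b i j)%:E &
      mutually_independent P [pred ij : 'I_t * 'I_t | (ij.1 < ij.2)%N]
        (fun ij => [set w | adj w ij.1 ij.2])].

Definition likelihood_equations e b : Prop :=
  forall i, (degree e i)%:R = \sum_(j | j != i) edge_prob b i j.

(* The estimator is an arbitrary random vector on the event that the likelihood
   equations do not have a unique solution. *)
Definition is_mle d (T : measurableType d) (adj : T -> rel 'I_t)
    (bhat : T -> 'cV[R]_t) : Prop :=
  (forall i, measurable_fun setT (fun w => bhat w i 0)) /\
  (forall w x, unique (likelihood_equations (adj w)) x -> bhat w = x).

Definition fisher_information b : 'M[R]_t :=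
  \matrix_(i, j) if i == j then \sum_(k | k != i) edge_var b i k
                 else edge_var b i j.

Definition sqrt_diag_fisher b : 'M[R]_t :=
  diag_mx (\row_i Num.sqrt (fisher_information b i i)).

Definition max_abs b : R := \big[Num.max/0]_(i < t) `|b i 0|.

End beta_model.

(* Main.v *)
(** Write p(u) = e^u / (1 + e^u), v = p', and let y_i = d_i - E d_i.

    Everything about the likelihood equations rests on a maximum principle for
    the operator z |-> S z, (S z)_i = sum_(j != i) v_ij (z_i + z_j): if v_ij is
    in [m, 1] and |S z| <= G then |z| <= 2 G / ((t - 2) m^2) in sup norm. Applied
    with mean-value weights v_ij it gives uniqueness of the estimator, and,
    through the first-order conditions of the negative log-likelihood minimised
    over a box of radius 1 around beta, its existence and a sup-norm rate. Applied to
    z_i = bhat_i - beta_i - y_i / v_ii, for which S z consists of quadratic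
    Taylor remainders and of the sums sum_j v_ij y_j / v_jj, it gives
    bhat_i - beta_i = y_i / v_ii + o(v_ii^(-1/2)). Exponential moments of sums
    over the independent edges control |y_i| and these weighted sums uniformly
    in i. Eventually max |beta_i| <= ln ln t, so that 1 / m <= (ln t)^3 and all
    the errors are powers of ln t divided by sqrt t.

    For the limit law of y_i / v_ii^(1/2), i < r, the edges among the first r
    vertices are dropped, and the edges are then averaged out one by one
    (Lindeberg): with Phi the normal distribution function, Phi (w / sqrt s)
    solves the heat equation, so averaging out one edge in
    prod_i Phi ((x_i - Y_i) / sqrt s_i) amounts, up to a third-order error, to
    increasing s_i by the variance of that edge. *)
Require Import Defs.
From HB Require Import structures.
From mathcomp Require Import all_boot all_order all_algebra.
From mathcomp Require Import all_classical all_reals all_analysis.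
From mathcomp Require Import measurable_realfun ring lra.

Set Implicit Arguments.
Unset Strict Implicit.
Unset Printing Implicit Defensive.

Import Order.TTheory GRing.Theory Num.Theory.
Import numFieldNormedType.Exports.

Local Open Scope classical_set_scope.
Local Open Scope ring_scope.

(** * The logistic function *)

Section logistic.
Context {R : realType}.
Implicit Types u h x y : R.

Definition logistic u := expR u / (1 + expR u).
Definition logistic_var u := expR u / (1 + expR u) ^+ 2.
(** The log-partition function of one edge: its first two derivatives are [logistic] and
    [logistic_var]. *)
Definition softplus u := ln (1 + expR u).

(** Differentiation rules for explicit lambda terms: derivatives are assembled by application, and
    only the resulting value remains to be checked algebraically. *)
Lemma is_derive_fctD (f g : R -> R) x a b :
  is_derive x 1 f a -> is_derive x 1 g b -> is_derive x 1 (fun y => f y + g y) (a + b).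
Proof. by move=> Df Dg; exact: is_deriveD. Qed.

Lemma is_derive_fctB (f g : R -> R) x a b :
  is_derive x 1 f a -> is_derive x 1 g b -> is_derive x 1 (fun y => f y - g y) (a - b).
Proof. by move=> Df Dg; exact: is_deriveB. Qed.

Lemma is_derive_fctM (f g : R -> R) x a b :
  is_derive x 1 f a -> is_derive x 1 g b ->
  is_derive x 1 (fun y => f y * g y) (a * g x + f x * b).
Proof.
move=> Df Dg; apply: is_derive_eq (is_deriveM Df Dg) _.
by rewrite /GRing.scale/= addrC [g x * a]mulrC.
Qed.

Lemma is_derive_fct_cst (c x : R) : is_derive x 1 (fun=> c) 0.
Proof. exact: is_derive_cst. Qed.

Lemma is_derive_fct_id x : is_derive x 1 (fun y : R => y) 1.
Proof. exact: is_derive_id. Qed.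

Lemma is_derive_fct_comp (f g : R -> R) x a b :
  is_derive (g x) 1 f a -> is_derive x 1 g b ->
  is_derive x 1 (fun y => f (g y)) (a * b).
Proof. by move=> Df Dg; exact: is_derive1_comp. Qed.

Lemma expR1_gt0 u : 0 < 1 + expR u.
Proof. by rewrite addr_gt0// expR_gt0. Qed.

Lemma logisticE u : logistic u = 1 - (1 + expR u)^-1.
Proof.
rewrite /logistic; have := lt0r_neq0 (expR1_gt0 u); move: (expR u) => e e0.
by field.
Qed.

Lemma logistic_varE u : logistic_var u = logistic u * (1 - logistic u).
Proof.
rewrite /logistic /logistic_var; have := lt0r_neq0 (expR1_gt0 u).
by move: (expR u) => e e0; field.
Qed.

Lemma logistic_gt0 u : 0 < logistic u.
Proof. by rewrite divr_gt0 ?expR1_gt0 ?expR_gt0. Qed.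

Lemma logistic_lt1 u : logistic u < 1.
Proof. by rewrite logisticE ltrBlDr ltrDl invr_gt0 expR1_gt0. Qed.

Lemma logistic_var_gt0 u : 0 < logistic_var u.
Proof. by rewrite divr_gt0 ?expR_gt0 ?exprn_gt0 ?expR1_gt0. Qed.

Lemma logistic_var_le1 u : logistic_var u <= 1.
Proof.
rewrite logistic_varE; have := logistic_gt0 u; have := logistic_lt1 u; nra.
Qed.

(** [1 + expR u] is at most twice the larger of 1 and [expR u], so squaring the denominator costs a
    factor 4. *)
Lemma logistic_var_ge u : expR (- `|u|) / 4 <= logistic_var u.
Proof.
rewrite /logistic_var.
have e0 := expR_gt0 u; have e1 := expR1_gt0 u.
rewrite ler_pdivlMr ?exprn_gt0//.
have [u0|u0] := leP 0 u.
  have : 1 <= expR u by rewrite leNgt expR_lt1 -leNgt.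
  rewrite ger0_norm// expRN => e2.
  rewrite mulrAC ler_pdivrMr// -mulrC ler_pdivrMr//; nra.
have : expR u <= 1 by rewrite expR_le1 ltW.
rewrite ltr0_norm// opprK => e2; nra.
Qed.

Lemma is_derive_expR1V u :
  is_derive u 1 (fun x => (1 + expR x)^-1) (- logistic_var u).
Proof.
have ne := lt0r_neq0 (expR1_gt0 u).
have D : is_derive u 1 (fun x => 1 + expR x) (expR u).
  apply: is_derive_eq (is_derive_fctD (is_derive_fct_cst 1 u) (is_derive_expR u)) _.
  by rewrite add0r.
have := @is_deriveV _ (fun x => 1 + expR x) _ _ _ ne D.
rewrite /GRing.scale/= => D2; apply: (is_derive_eq D2).
by rewrite /logistic_var mulNr mulrC.
Qed.

Lemma is_derive_logistic u : is_derive u 1 logistic (logistic_var u).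
Proof.
have D := is_derive_expR1V u.
rewrite (_ : logistic = (fun x => 1 - (1 + expR x)^-1)); last first.
  by apply/funext => x; rewrite logisticE.
apply: is_derive_eq (is_derive_fctB (is_derive_fct_cst 1 u) D) _.
by rewrite opprK add0r.
Qed.

Lemma is_derive_logistic_var u :
  is_derive u 1 logistic_var (logistic_var u * (1 - 2 * logistic u)).
Proof.
have D := is_derive_logistic u.
rewrite (_ : logistic_var = (fun x => logistic x * (1 - logistic x))); last first.
  by apply/funext => x; rewrite logistic_varE.
apply: is_derive_eq
  (is_derive_fctM D (is_derive_fctB (is_derive_fct_cst 1 u) D)) _.
by rewrite logistic_varE; ring.
Qed.

Lemma is_derive_softplus u : is_derive u 1 softplus (logistic u).
Proof.
have D : is_derive u 1 (fun x => 1 + expR x) (expR u).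
  apply: is_derive_eq (is_derive_fctD (is_derive_fct_cst 1 u) (is_derive_expR u)) _.
  by rewrite add0r.
have D2 : is_derive u 1 softplus ((1 + expR u)^-1 * expR u).
  exact: (@is_derive_fct_comp (@ln R) (fun x => 1 + expR x) _ _ _
    (is_derive1_ln (expR1_gt0 u)) D).
apply: (is_derive_eq D2).
by rewrite mulrC.
Qed.

Lemma is_derive_continuous (f : R -> R) x (df : R) :
  is_derive x 1 f df -> {for x, continuous f}.
Proof.
by move=> D; apply/differentiable_continuous/derivable1_diffP; case: D.
Qed.

Lemma MVT_two_points (f df : R -> R) x y :
  (forall z : R, is_derive z 1 f (df z)) ->
  exists2 c, `|c - x| <= `|y - x| & f y - f x = df c * (y - x).
Proof.
move=> D.
have C a b : {within `[a, b], continuous f}.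
  by apply: continuous_subspaceT => z; exact: is_derive_continuous (D z).
have [xy|/ltW yx] := leP x y.
  have [c + ->] := MVT_segment xy (fun z _ => D z) (C _ _).
  rewrite in_itv/= => /andP[h1 h2]; exists c => //.
  by rewrite !ger0_norm ?subr_ge0// lerB.
have [c + e] := MVT_segment yx (fun z _ => D z) (C _ _).
rewrite in_itv/= => /andP[h1 h2]; exists c.
  by rewrite !ler0_norm ?subr_le0// lerN2 lerB.
by rewrite -opprB e -mulrN opprB.
Qed.

Lemma Lipschitz_derive (f df : R -> R) (K : R) x y :
  (forall z : R, is_derive z 1 f (df z)) -> (forall z, `|df z| <= K) ->
  `|f y - f x| <= K * `|y - x|.
Proof.
move=> D dK; have [c _ ->] := MVT_two_points x y D.
by rewrite normrM ler_wpM2r.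
Qed.

Lemma logistic_var_lip x y : `|logistic_var y - logistic_var x| <= `|y - x|.
Proof.
rewrite -[leRHS]mul1r; apply: (Lipschitz_derive _ _ is_derive_logistic_var).
move=> z; have := logistic_gt0 z; have := logistic_lt1 z.
have := logistic_var_gt0 z; have := logistic_var_le1 z => a b c e.
by rewrite ler_norml; apply/andP; split; nra.
Qed.

(** The increment is [logistic_var c * h] with [c] within [|h|] of [u], and [logistic_var] is
    1-Lipschitz. *)
Lemma logistic_taylor u h :
  `|logistic (u + h) - logistic u - logistic_var u * h| <= h ^+ 2.
Proof.
have [c + ->] := MVT_two_points u (u + h) is_derive_logistic.
rewrite [u + h - u]addrAC subrr add0r -mulrBl normrM => cu.
rewrite -[leRHS]real_normK ?num_real// expr2 ler_wpM2r// (le_trans (logistic_var_lip _ _))//.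
Qed.

(** Convexity: the tangent of [softplus] at [u + h] lies below its graph at [u]. *)
Lemma softplus_le u h : softplus (u + h) - softplus u <= logistic (u + h) * h.
Proof.
have mono x y : x <= y -> logistic x <= logistic y.
  move=> xy; rewrite !logisticE lerD2l lerN2 lef_pV2 ?posrE ?expR1_gt0//.
  by rewrite lerD2l ler_expR.
have C a b : {within `[a, b], continuous softplus}.
  apply: continuous_subspaceT => z.
  exact: is_derive_continuous (is_derive_softplus z).
have [h0|/ltW h0] := leP 0 h.
  have uh : u <= u + h by rewrite lerDl.
  have [c + ->] := MVT_segment uh (fun z _ => is_derive_softplus z) (C _ _).
  rewrite in_itv/= [u + h - u]addrAC subrr add0r => /andP[_ cu].
  by rewrite ler_wpM2r// mono.
have uh : u + h <= u by rewrite gerDl.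
have [c + e] := MVT_segment uh (fun z _ => is_derive_softplus z) (C _ _).
rewrite in_itv/= => /andP[cu _].
by rewrite -opprB e opprD addrA subrr add0r mulrN opprK ler_wnM2r// mono.
Qed.

End logistic.

(** * Maximum principle *)

Section max_principle.
Context {R : realFieldType} {n : nat}.
Implicit Types (i j : 'I_n) (z : 'I_n -> R) (v : 'I_n -> 'I_n -> R).

Lemma sum_ord_neq (F : 'I_n -> R) i :
  \sum_(j | j != i) F j = \sum_j F j - F i.
Proof. by rewrite [in RHS](bigD1 i)//= addrC addrK. Qed.

Lemma sum_ord_neq_cst i (c : R) : \sum_(j | j != i) c = (n%:R - 1) * c.
Proof. by rewrite sum_ord_neq sumr_const card_ord mulrBl mul1r mulr_natl. Qed.

(* At a maximiser [a] of |z| with z a > 0 almost all the z j must be close to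
   - z a; at a minimiser almost all must then be close to z a. *)
Lemma max_principle_at v z (m G : R) (a : 'I_n) :
  (2 < n)%N -> 0 < m <= 1 -> 0 <= G ->
  (forall i j, j != i -> m <= v i j <= 1) ->
  (forall i, 0 < z i -> \sum_(j | j != i) v i j * (z i + z j) <= G) ->
  (forall i, z i < 0 -> - G <= \sum_(j | j != i) v i j * (z i + z j)) ->
  0 < z a -> (forall j, `|z j| <= z a) ->
  z a <= 2 * G / ((n%:R - 2) * m ^+ 2).
Proof.
move=> n2 /andP[m0 m1] G0 vm Hp Hn za0 za.
have zle j : z j <= z a by rewrite (le_trans _ (za j))// ler_norm.
have zge j : 0 <= z a + z j.
  by rewrite -lerBlDl sub0r lerNl (le_trans _ (za j))// -normrN ler_norm.
have n2R : 0 < n%:R - 2 :> R by rewrite subr_gt0 ltr_nat.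
have [b _ minb] : exists2 b : 'I_n, true & forall j, z b <= z j.
  case: (@arg_minP _ _ _ a xpredT z isT) => b _ h; exists b => // j; exact: h.
set T1 := \sum_(j | j != a) (z a + z j).
have hT1 : m * T1 <= G.
  apply: le_trans (Hp a za0); rewrite mulr_sumr ler_sum// => j ja.
  by rewrite ler_wpM2r//; case/andP: (vm a j ja).
have hT1b : (n%:R - 1) * (z a + z b) <= T1.
  by rewrite -(sum_ord_neq_cst a) ler_sum// => j _; rewrite lerD2l.
have ub_of (N : R) : N * z a * m ^+ 2 <= 2 * G -> n%:R - 2 <= N ->
    z a <= 2 * G / ((n%:R - 2) * m ^+ 2).
  move=> h hN; rewrite ler_pdivlMr ?mulr_gt0 ?exprn_gt0//.
  apply: le_trans h; rewrite mulrA ler_wpM2r ?exprn_ge0 ?(ltW m0)//.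
  by rewrite mulrC ler_wpM2r// ltW.
have [zb0|zb0] := leP 0 (z b).
  apply: (ub_of (n%:R - 1)); last by lra.
  have h : (n%:R - 1) * z a <= T1.
    by apply: le_trans hT1b; rewrite ler_wpM2l ?lerDl//; lra.
  rewrite expr2 mulrA; apply: le_trans (_ : G * m <= _); last by nra.
  rewrite ler_wpM2r ?(ltW m0)//; apply: le_trans hT1.
  by rewrite mulrC ler_wpM2l// ltW.
(* At [b] each term is split around [z a]: the nonnegative [z a + z b] carries a weight at most 1,
   the nonnegative [z a - z k] a weight at least [m]. *)
set T2 := \sum_(k | k != b) (z a - z k).
have hT2 : m * T2 <= G + (n%:R - 1) * (z a + z b).
  rewrite -lerBlDr -lerN2; apply: le_trans (Hn b zb0) _.
  rewrite opprB -(sum_ord_neq_cst b) mulr_sumr -sumrB ler_sum// => k kb.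
  have /andP[v1 v2] := vm b k kb.
  have -> : z b + z k = (z a + z b) - (z a - z k) by ring.
  rewrite mulrBr lerB//; first by rewrite ler_piMl// zge.
  by rewrite ler_wpM2r// subr_ge0 zle.
(* The sums of the [z j] cancel in [T1 + T2], and [z b >= - z a] leaves at least [2 (n - 2) z a]. *)
have e12 : T1 + T2 = (2 * n%:R - 3) * z a + z b.
  rewrite /T1 /T2 !sum_ord_neq big_split /= sumrB.
  have cst : \sum_(j < n) z a = n%:R * z a.
    by rewrite sumr_const card_ord mulr_natl.
  by rewrite cst; ring.
apply: (ub_of (n%:R - 2)) => //.
have := zge b => zb1.
have m2 : m * m <= m by nra.
have h1 : m * (T1 + T2) <= G + (G + T1) by nra.
have h2 : m * (m * (T1 + T2)) <= 3 * G by nra.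
have h3 : 2 * (n%:R - 2) * z a <= T1 + T2 by rewrite e12; nra.
have h4 : m * (m * (2 * (n%:R - 2) * z a)) <= 3 * G.
  by apply: le_trans h2; rewrite !ler_pM2l.
by rewrite expr2; lra.
Qed.

(** Each bound is asked only where [z i] has the matching sign, which is what the one-sided
    optimality conditions of a box minimiser provide. Passing to [- z] exchanges the two bounds and
    reduces to [max_principle_at]. *)
Lemma max_principle v z (m G : R) :
  (2 < n)%N -> 0 < m <= 1 -> 0 <= G ->
  (forall i j, j != i -> m <= v i j <= 1) ->
  (forall i, 0 < z i -> \sum_(j | j != i) v i j * (z i + z j) <= G) ->
  (forall i, z i < 0 -> - G <= \sum_(j | j != i) v i j * (z i + z j)) ->
  forall i, `|z i| <= 2 * G / ((n%:R - 2) * m ^+ 2).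
Proof.
move=> n2 m01 G0 vm Hp Hn i.
have [a _ maxa] : exists2 a : 'I_n, true & forall j, `|z j| <= `|z a|.
  case: (@arg_maxP _ _ _ i xpredT (fun j => `|z j|) isT) => a _ h.
  by exists a => // j; exact: h.
apply: le_trans (maxa i) _.
have [za|za|->] := ltgtP (z a) 0.
- rewrite ltr0_norm//; apply: (@max_principle_at v (fun j => - z j)) => //.
  + move=> j; rewrite oppr_gt0 => /Hn; rewrite lerNl -sumrN.
    by under eq_bigr do rewrite -mulrN opprD.
  + move=> j; rewrite oppr_lt0 => /Hp; rewrite -lerN2 -sumrN.
    by under eq_bigr do rewrite -mulrN opprD.
  + by rewrite oppr_gt0.
  + by move=> j; rewrite normrN -(ltr0_norm za).
- rewrite gtr0_norm//; apply: (@max_principle_at v) => // j.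
  by rewrite -(gtr0_norm za).
- rewrite normr0 divr_ge0 ?mulr_ge0// ?exprn_ge0//.
    by rewrite subr_ge0 ler_nat ltnW.
  all: by case/andP: m01 => /ltW.
Qed.

End max_principle.

Lemma continuous_sum (T : topologicalType) (R : realType) (I : Type) (r : seq I)
    (P : pred I) (F : I -> T -> R) :
  (forall i, P i -> continuous (F i)) ->
  continuous (fun x => \sum_(i <- r | P i) F i x).
Proof.
move=> cF; elim: r => [|i r IH] x.
  by under eq_fun do rewrite big_nil; exact: cst_continuous.
under eq_fun do rewrite big_cons.
case: ifPn => [Pi|_]; last exact: IH.
by apply: continuousD; [exact: cF|exact: IH].
Qed.

(** * The likelihood equations *)

Section likelihood.
Context {R : realType} {n : nat}.
Implicit Types (i j : 'I_n) (b d x y z : 'I_n -> R).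

Lemma sum_sym_neq (q : 'I_n -> 'I_n -> R) (c : 'I_n -> R) :
  (forall i j, q i j = q j i) ->
  \sum_i \sum_(j | j != i) q i j * (c i + c j) =
  2 * \sum_i c i * \sum_(j | j != i) q i j.
Proof.
move=> qC.
rewrite (eq_bigr (fun i => \sum_(j | j != i) c i * q i j +
                           \sum_(j | j != i) c j * q j i)); last first.
  move=> i _; rewrite -big_split/=; apply: eq_bigr => j _.
  by rewrite mulrDr mulrC [q i j * c j]mulrC (qC i j).
rewrite big_split/= [X in _ + X](exchange_big_dep predT)//=.
rewrite mulr_natl mulr2n; congr (_ + _); apply: eq_bigr => i _.
  by rewrite mulr_sumr.
by rewrite mulr_sumr; apply: eq_bigl => j; rewrite eq_sym.
Qed.

Definition score d x i : R := \sum_(j | j != i) logistic (x i + x j) - d i.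

(** The factor 1/2 compensates for the double sum meeting each edge twice; the gradient of this
    function is [score d]. *)
Definition neg_loglik d x : R :=
  2^-1 * \sum_i \sum_(j | j != i) softplus (x i + x j) - \sum_i d i * x i.

(** First-order convexity inequality with the slope taken at [y], obtained from [softplus_le] pair
    by pair. It takes the place of differentiating [neg_loglik]. *)
Lemma neg_loglik_le d x y :
  neg_loglik d y - neg_loglik d x <= \sum_i (y i - x i) * score d y i.
Proof.
have := @sum_sym_neq (fun i j => logistic (y i + y j)) (fun i => y i - x i).
move=> /(_ (fun i j => congr1 logistic (addrC _ _))) e.
rewrite /score; under [leRHS]eq_bigr do rewrite mulrBr.
rewrite sumrB -[X in _ <= X - _]mul1r -[X in X * _ - _](@mulVf _ 2)// -mulrA -e.
under [X in _ <= _ - X]eq_bigr do rewrite mulrBl -[y _ * _]mulrC -[x _ * _]mulrC.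
rewrite sumrB /neg_loglik.
rewrite [leLHS](_ : _ = 2^-1 * (\sum_i \sum_(j | j != i) softplus (y i + y j) -
  \sum_i \sum_(j | j != i) softplus (x i + x j)) -
  (\sum_i d i * y i - \sum_i d i * x i)); last by ring.
rewrite lerD2r ler_pM2l// -sumrB ler_sum// => i _.
rewrite -sumrB ler_sum// => j _.
have -> : x i + x j = y i + y j - (y i - x i + (y j - x j)) by ring.
set h := _ + (y j - x j).
rewrite -{1}[y i + y j](subrK h).
apply: le_trans (softplus_le _ _) _.
by rewrite subrK.
Qed.

Lemma score_lip d x y i (h : R) :
  y i = x i + h -> (forall j, j != i -> y j = x j) ->
  `|score d y i - score d x i| <= n%:R * `|h|.
Proof.
move=> yi yj; rewrite /score opprB addrA subrK -sumrB.
apply: le_trans (ler_norm_sum _ _ _) _.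
apply: (@le_trans _ _ (\sum_(j | j != i) `|h|)); last first.
  by rewrite sum_ord_neq_cst ler_wpM2r// lerBlDr lerDl.
apply: ler_sum => j ji; rewrite (yj j ji) yi.
have -> : `|h| = 1 * `|(x i + h + x j) - (x i + x j)|.
  by rewrite mul1r; congr `|_|; ring.
apply: (@Lipschitz_derive _ logistic logistic_var) => [z|z].
  exact: is_derive_logistic.
by rewrite ger0_norm ?logistic_var_le1// ltW// logistic_var_gt0.
Qed.

Lemma box_minimizer d b (rho : R) : 0 < rho ->
  exists x, (forall i, `|x i - b i| <= rho) /\
    forall y, (forall i, `|y i - b i| <= rho) -> neg_loglik d x <= neg_loglik d y.
Proof.
move=> rho0.
pose A : set 'rV[R]_n := [set x | forall i, `[b i - rho, b i + rho]%classic (x ord0 i)].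
have cA : compact A.
  apply: (@rV_compact R n (fun i => `[b i - rho, b i + rho]%classic)) => i.
  exact: segment_compact.
have inA (x : 'rV[R]_n) : A x <-> forall i, `|x ord0 i - b i| <= rho.
  by split => h i; move: (h i); rewrite /= in_itv/= ler_distl.
have A0 : A !=set0.
  by exists (\row_i b i); apply/inA => i; rewrite mxE subrr normr0 ltW.
have cf : continuous (fun x : 'rV[R]_n => neg_loglik d (fun i => x ord0 i)).
  have cc i : continuous (fun x : 'rV[R]_n => x ord0 i).
    exact: coord_continuous.
  have cs : continuous (fun x : 'rV[R]_n =>
      \sum_i \sum_(j | j != i) softplus (x ord0 i + x ord0 j)).
    apply: continuous_sum => i _; apply: continuous_sum => j _ x.
    apply: (@continuous_comp _ _ _ (fun x : 'rV[R]_n => x ord0 i + x ord0 j)).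
      by apply: continuousD; exact: cc.
    exact: is_derive_continuous (is_derive_softplus _).
  have cl : continuous (fun x : 'rV[R]_n => \sum_i d i * x ord0 i).
    apply: continuous_sum => i _ x.
    by apply: continuousM; [exact: cst_continuous|exact: cc].
  move=> x; apply: (@continuousB _ _ _
    (fun x : 'rV[R]_n => 2^-1 * \sum_i \sum_(j | j != i) softplus (x ord0 i + x ord0 j))
    (fun x : 'rV[R]_n => \sum_i d i * x ord0 i)).
    by apply: continuousM; [exact: cst_continuous|exact: cs].
  exact: cl.
have [x xA xmin] := EVT_min_rV A0 cA (continuous_subspaceT cf).
exists (fun i => x ord0 i); split; first by apply/inA; rewrite inE in xA.
move=> y yb; have := xmin (\row_i y i).
rewrite inE => /(_ _)/le_trans; apply; first by apply/inA => i; rewrite mxE.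
by rewrite le_eqVlt; apply/orP; left; apply/eqP; congr (neg_loglik d _);
  apply/funext => i; rewrite mxE.
Qed.

(** If the score had the wrong sign in a free direction, a small move of coordinate [i] would
    preserve that sign, by [score_lip], and convexity would push the objective below its minimum. *)
Lemma box_minimizer_kkt d b x (rho : R) :
  (forall i, `|x i - b i| <= rho) ->
  (forall y, (forall i, `|y i - b i| <= rho) -> neg_loglik d x <= neg_loglik d y) ->
  forall i, (x i < b i + rho -> 0 <= score d x i) /\
            (b i - rho < x i -> score d x i <= 0).
Proof.
move=> xb xmin i.
pose y (h : R) j := if j == i then x i + h else x j.
have yi h : y h i = x i + h by rewrite /y eqxx.
have yj h j : j != i -> y h j = x j by rewrite /y => /negbTE ->.
have ykey h : `|x i + h - b i| <= rho -> 0 <= h * score d (y h) i.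
  move=> hb; have : neg_loglik d x <= neg_loglik d (y h).
    apply: xmin => j; have [->|ji] := eqVneq j i; first by rewrite yi.
    by rewrite yj.
  rewrite -subr_ge0 => /le_trans/(_ (neg_loglik_le _ _ _)).
  rewrite (bigD1 i)//= big1 ?addr0 ?yi; last first.
    by move=> j ji; rewrite yj// subrr mul0r.
  by rewrite [x i + h - _]addrAC subrr add0r.
have ylip h := score_lip d (yi h) (yj h).
have n0 : 0 < n%:R + 1 :> R by rewrite ltr_wpDl.
have := xb i; rewrite ler_distl => /andP[lb ub].
split => hx; rewrite leNgt; apply/negP => s0.
(* Dividing by [n + 1] rather than [n] keeps the score strictly negative after the move, since the
   move changes it by at most [n h]. *)
- set h := Num.min (b i + rho - x i) (- score d x i / (n%:R + 1)).
  have h0 : 0 < h by rewrite lt_min subr_gt0 hx divr_gt0 ?oppr_gt0.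
  have h1 : h <= b i + rho - x i by rewrite ge_min lexx.
  have h2 : h * (n%:R + 1) <= - score d x i.
    by rewrite -ler_pdivlMr// ge_min lexx orbT.
  have : 0 <= h * score d (y h) i by apply: ykey; rewrite ler_distl; lra.
  rewrite pmulr_rge0//; have := ylip h; rewrite [`|h|]ger0_norm ?(ltW h0)//.
  by rewrite ler_norml => /andP[_]; lra.
- set h := Num.min (x i - (b i - rho)) (score d x i / (n%:R + 1)).
  have h0 : 0 < h by rewrite lt_min subr_gt0 hx divr_gt0.
  have h1 : h <= x i - (b i - rho) by rewrite ge_min lexx.
  have h2 : h * (n%:R + 1) <= score d x i.
    by rewrite -ler_pdivlMr// ge_min lexx orbT.
  have : 0 <= (- h) * score d (y (- h)) i by apply: ykey; rewrite ler_distl; lra.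
  rewrite nmulr_rge0 ?oppr_lt0//; have := ylip (- h).
  by rewrite normrN [`|h|]ger0_norm ?(ltW h0)// ler_norml => /andP[+ _]; lra.
Qed.

(** Mean-value weights for all pairs at once: differences of expected degrees take the form of the
    operator in the maximum principle, with weights [logistic_var (c i j)]. *)
Lemma logistic_secant b x : exists c : 'I_n -> 'I_n -> R, forall i j,
  `|c i j - (b i + b j)| <= `|x i - b i + (x j - b j)| /\
  logistic (x i + x j) - logistic (b i + b j) =
    logistic_var (c i j) * (x i - b i + (x j - b j)).
Proof.
have H (ij : 'I_n * 'I_n) : exists c,
    `|c - (b ij.1 + b ij.2)| <= `|x ij.1 - b ij.1 + (x ij.2 - b ij.2)| /\
    logistic (x ij.1 + x ij.2) - logistic (b ij.1 + b ij.2) =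
      logistic_var c * (x ij.1 - b ij.1 + (x ij.2 - b ij.2)).
  have [c c1 c2] := MVT_two_points (b ij.1 + b ij.2) (x ij.1 + x ij.2)
    is_derive_logistic.
  have e : x ij.1 + x ij.2 - (b ij.1 + b ij.2) =
    x ij.1 - b ij.1 + (x ij.2 - b ij.2) by ring.
  by exists c; rewrite -e.
have [c hc] := choice H.
by exists (fun i j => c (i, j)) => i j; exact: (hc (i, j)).
Qed.

(** Where [x i > b i] the box minimiser is off the lower face, so its score is at most 0, and
    symmetrically where [x i < b i]. With the bound on the score at [b] this gives both inequalities
    of the maximum principle. *)
Lemma mle_exists d b (m G K rho : R) :
  (2 < n)%N -> 0 < m <= 1 -> 0 <= G -> 0 < rho ->
  (forall i, `|b i| <= K) ->
  (forall u, `|u| <= 2 * K + 2 * rho -> m <= logistic_var u) ->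
  (forall i, `|score d b i| <= G) ->
  2 * G / ((n%:R - 2) * m ^+ 2) < rho ->
  exists x, (forall i, `|x i - b i| <= 2 * G / ((n%:R - 2) * m ^+ 2)) /\
            (forall i, score d x i = 0).
Proof.
move=> n2 m01 G0 rho0 bK mv sG Grho.
have [x [xb xmin]] := box_minimizer d b rho0.
have kkt := box_minimizer_kkt xb xmin.
have [c hc] := logistic_secant b x.
have vc i j : m <= logistic_var (c i j) <= 1.
  rewrite logistic_var_le1 andbT; apply: mv.
  have [h _] := hc i j.
  rewrite -[c i j](subrK (b i + b j)) (le_trans (ler_normD _ _))// addrC lerD//.
    by rewrite (le_trans (ler_normD _ _))// mulr_natl mulr2n lerD.
  apply: (le_trans h); rewrite (le_trans (ler_normD _ _))//.
  by rewrite mulr_natl mulr2n lerD.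
have Se i : \sum_(j | j != i) logistic_var (c i j) * (x i - b i + (x j - b j)) =
    score d x i - score d b i.
  rewrite /score opprB addrA subrK -sumrB; apply: eq_bigr => j _.
  by have [_ ->] := hc i j.
have zb : forall i, `|x i - b i| <= 2 * G / ((n%:R - 2) * m ^+ 2).
  apply: (@max_principle _ _ (fun i j => logistic_var (c i j))
    (fun i => x i - b i)) => //.
  - move=> i zi; rewrite Se; have [_ h] := kkt i.
    have {h} : score d x i <= 0 by apply: h; lra.
    by have := sG i; rewrite ler_norml; lra.
  - move=> i zi; rewrite Se; have [h _] := kkt i.
    have {h} : 0 <= score d x i by apply: h; lra.
    by have := sG i; rewrite ler_norml; lra.
(* The bound is strictly below [rho], so no coordinate lies on a face of the box and both one-sided
   conditions apply. *)
exists x; split => // i; have := le_lt_trans (zb i) Grho.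
rewrite ltr_distl => /andP[h1 h2]; have [k1 k2] := kkt i.
by apply/eqP; rewrite eq_le k1 ?k2.
Qed.

(** The operator with mean-value weights annihilates the difference of two solutions, so the maximum
    principle applies with [G = 0] and any positive lower bound for these finitely many weights. *)
Lemma mle_unique d x y : (2 < n)%N ->
  (forall i, score d x i = 0) -> (forall i, score d y i = 0) -> x = y.
Proof.
move=> n2 sx sy; have [c hc] := logistic_secant y x.
pose K : R := \sum_i \sum_j `|c i j|.
have cK i j : `|c i j| <= K.
  rewrite /K (bigD1 i)//= (bigD1 j)//= -addrA lerDl addr_ge0 ?sumr_ge0// => k _.
  exact: sumr_ge0.
have m0 : 0 < expR (- K) / 4 by rewrite divr_gt0// expR_gt0.
have m1 : expR (- K) / 4 <= 1.
  have : expR (- K) <= 1.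
    by rewrite expR_le1 oppr_le0; do 2![apply: sumr_ge0 => ? _].
  by lra.
have Se i : \sum_(j | j != i) logistic_var (c i j) * (x i - y i + (x j - y j)) = 0.
  transitivity (score d x i - score d y i); last by rewrite sx sy subrr.
  rewrite /score opprB addrA subrK -sumrB; apply: eq_bigr => j _.
  by have [_ ->] := hc i j.
have zb := @max_principle _ _ (fun i j => logistic_var (c i j))
    (fun i => x i - y i) (expR (- K) / 4) 0 n2.
apply/funext => i; apply/eqP; rewrite -subr_eq0 -normr_le0.
have := zb; rewrite mulr0 mul0r; apply => //.
- by rewrite m0.
- move=> k j _; rewrite logistic_var_le1 andbT (le_trans _ (logistic_var_ge _))//.
  by rewrite ler_pM2r// ler_expR lerN2.
- by move=> k _; rewrite Se.
- by move=> k _; rewrite Se oppr0.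
Qed.

(** * Linearisation of the estimator *)

Definition fisher_diag b i : R := \sum_(j | j != i) logistic_var (b i + b j).

(** In the operator applied to [z2], the diagonal contribution of [score d b i / fisher_diag b i]
    cancels the linear part [- score d b i] of the likelihood equation. There remain the Taylor
    remainders [R2], at most [n (2 rho)^2], and the weighted sums bounded by [H]. *)
Lemma mle_expansion d b x (m rho H : R) :
  (2 < n)%N -> 0 < m <= 1 -> 0 <= H ->
  (forall i j, m <= logistic_var (b i + b j)) ->
  (forall i, score d x i = 0) ->
  (forall i, `|x i - b i| <= rho) ->
  (forall i, `|\sum_(j | j != i) logistic_var (b i + b j) / fisher_diag b j *
      score d b j| <= H) ->
  forall i, `|x i - b i + score d b i / fisher_diag b i| <=
    2 * (4 * n%:R * rho ^+ 2 + H) / ((n%:R - 2) * m ^+ 2).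
Proof.
move=> n2 m01 H0 mv sx xb hH.
have n2R : 2 < n%:R :> R by rewrite ltr_nat.
have D0 i : 0 < fisher_diag b i.
  apply: lt_le_trans (_ : (n%:R - 1) * m <= _).
    by rewrite mulr_gt0//; [lra|case/andP: m01].
  by rewrite -(sum_ord_neq_cst i) ler_sum.
have rho0 : 0 <= rho.
  have i0 : 'I_n by case: (n) n2 => // k _; exact: ord0.
  exact: le_trans (xb i0).
pose z2 i := x i - b i + score d b i / fisher_diag b i.
pose R2 i := \sum_(j | j != i) (logistic (x i + x j) - logistic (b i + b j) -
  logistic_var (b i + b j) * (x i - b i + (x j - b j))).
have R2b i : `|R2 i| <= 4 * n%:R * rho ^+ 2.
  apply: le_trans (ler_norm_sum _ _ _) _.
  apply: (@le_trans _ _ (\sum_(j | j != i) (4 * rho ^+ 2))); last first.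
    by rewrite sum_ord_neq_cst; have := exprn_ge0 2 rho0; lra.
  apply: ler_sum => j _.
  have -> : x i + x j = b i + b j + (x i - b i + (x j - b j)) by ring.
  apply: le_trans (logistic_taylor _ _) _.
  have -> : 4 * rho ^+ 2 = (rho + rho) ^+ 2 by ring.
  rewrite -[leLHS]real_normK ?num_real// lerXn2r ?nnegrE ?addr_ge0//.
  by rewrite (le_trans (ler_normD _ _))// lerD.
have Se i : \sum_(j | j != i) logistic_var (b i + b j) * (z2 i + z2 j) =
    - R2 i + \sum_(j | j != i) logistic_var (b i + b j) / fisher_diag b j *
      score d b j.
  have -> : \sum_(j | j != i) logistic_var (b i + b j) * (z2 i + z2 j) =
    \sum_(j | j != i) logistic_var (b i + b j) * (x i - b i + (x j - b j)) +
    (\sum_(j | j != i) logistic_var (b i + b j)) * (score d b i / fisher_diag b i) +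
    \sum_(j | j != i) logistic_var (b i + b j) / fisher_diag b j * score d b j.
    rewrite mulr_suml -!big_split/=; apply: eq_bigr => j _.
    by rewrite /z2; ring.
  congr (_ + _); rewrite -/(fisher_diag b i) [fisher_diag b i * _]mulrC divfK ?gt_eqF//.
  have e : \sum_(j | j != i) (logistic (x i + x j) - logistic (b i + b j)) =
      - score d b i.
    by have := sx i; rewrite sumrB /score => /eqP; rewrite subr_eq0 => /eqP ->; ring.
  by rewrite /R2 sumrB opprB e opprK.
have Sb i : `|\sum_(j | j != i) logistic_var (b i + b j) * (z2 i + z2 j)| <=
    4 * n%:R * rho ^+ 2 + H.
  by rewrite Se (le_trans (ler_normD _ _))// normrN lerD.
apply: (@max_principle _ _ (fun i j => logistic_var (b i + b j)) z2) => //.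
- by rewrite addr_ge0// !mulr_ge0// exprn_ge0.
- by move=> i j _; rewrite mv logistic_var_le1.
- by move=> i _; exact: le_trans (ler_norm _) (Sb i).
- by move=> i _; have := Sb i; rewrite ler_norml => /andP[].
Qed.

End likelihood.

(** * Independent Bernoulli variables *)

Section bernoulli_product.
Context {R : realType} {I : eqType}.
Implicit Types (p a : I -> R) (g h : I -> bool) (F : (I -> bool) -> R).
Implicit Types l : seq I.

Definition upd g (e : I) (c : bool) : I -> bool :=
  fun i => if i == e then c else g i.

(* Expectation over independent Bernoulli(p e) values at the e in l, the values
   of the configuration outside of l being those of g. *)
Fixpoint Ex p l F g : R :=
  match l with
  | [::] => F g
  | e :: l' => p e * Ex p l' F (upd g e true) + (1 - p e) * Ex p l' F (upd g e false)
  end.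

Lemma upd_neq g e c i : i != e -> upd g e c i = g i.
Proof. by rewrite /upd => /negbTE ->. Qed.

Lemma upd_eq g e c : upd g e c e = c.
Proof. by rewrite /upd eqxx. Qed.

Lemma Ex_eq p l F F' g :
  (forall h, (forall i, i \notin l -> h i = g i) -> F h = F' h) ->
  Ex p l F g = Ex p l F' g.
Proof.
elim: l g => [|e l IH] g FF' /=; first exact: FF'.
by congr (_ * _ + _ * _); apply: IH => h hg; apply: FF' => i;
  rewrite in_cons negb_or => /andP[ie il]; rewrite hg// upd_neq.
Qed.

Lemma Ex_cst p l (c : R) g : Ex p l (fun=> c) g = c.
Proof. by elim: l g => [//|e l IH] g /=; rewrite !IH; ring. Qed.

Lemma ExD p l F F' g : Ex p l (fun h => F h + F' h) g = Ex p l F g + Ex p l F' g.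
Proof. by elim: l g => [//|e l IH] g /=; rewrite !IH; ring. Qed.

Lemma ExZ p l (c : R) F g : Ex p l (fun h => c * F h) g = c * Ex p l F g.
Proof. by elim: l g => [//|e l IH] g /=; rewrite !IH; ring. Qed.

Lemma Ex_sum p l (J : Type) (r : seq J) (F : J -> (I -> bool) -> R) g :
  Ex p l (fun h => \sum_(j <- r) F j h) g = \sum_(j <- r) Ex p l (F j) g.
Proof.
elim: r => [|j r IH].
  by rewrite big_nil (@Ex_eq _ _ _ (fun=> 0)) ?Ex_cst// => h _; rewrite big_nil.
rewrite big_cons -IH -ExD; apply: Ex_eq => h _; rewrite big_cons//.
Qed.

Lemma Ex_le p l F F' g : (forall e, 0 <= p e <= 1) ->
  (forall h, F h <= F' h) -> Ex p l F g <= Ex p l F' g.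
Proof.
move=> p01 FF'; elim: l g => [|e l IH] g /=; first exact: FF'.
by have /andP[p0 p1] := p01 e; rewrite lerD// ler_wpM2l ?subr_ge0.
Qed.

Definition centered_sum p a l h : R :=
  \sum_(e <- l) a e * ((h e)%:R - p e).

Lemma centered_sum_upd p a l g h e c : e \notin l ->
  (forall i, i \notin l -> h i = upd g e c i) ->
  centered_sum p a (e :: l) h = a e * (c%:R - p e) + centered_sum p a l h.
Proof. by move=> el hg; rewrite /centered_sum big_cons (hg e)// upd_eq. Qed.

(** Inverting [expR (- x) >= 1 - x] gives [expR x <= 1 / (1 - x)], which is at most the quadratic on
    this range. *)
Lemma expR_le_quadratic (x : R) : `|x| <= 2^-1 -> expR x <= 1 + x + 2 * x ^+ 2.
Proof.
rewrite ler_norml => /andP[x1 x2].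
have := expR_ge1Dx (- x); rewrite expRN => h.
have x0 : 0 < 1 - x by lra.
have : expR x <= (1 - x)^-1.
  by rewrite -[leLHS]invrK lef_pV2 ?posrE// invr_gt0 expR_gt0.
move=> /le_trans; apply; rewrite -[leLHS]mul1r ler_pdivrMr//.
have -> : (1 + x + 2 * x ^+ 2) * (1 - x) = 1 + x ^+ 2 * (1 - 2 * x) by ring.
by rewrite lerDl mulr_ge0 ?sqr_ge0//; lra.
Qed.

(** After the quadratic bound the linear terms cancel, the variable being centred, and the variance
    [q (1 - q)] is at most 1. *)
Lemma bernoulli_mgf (q c : R) : 0 <= q <= 1 -> `|c| <= 2^-1 ->
  q * expR (c * (1 - q)) + (1 - q) * expR (c * (0 - q)) <= expR (2 * c ^+ 2).
Proof.
move=> /andP[q0 q1] c1.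
have h1 : expR (c * (1 - q)) <= 1 + c * (1 - q) + 2 * (c * (1 - q)) ^+ 2.
  apply: expR_le_quadratic; rewrite normrM (le_trans _ c1)// ler_piMr//.
  by rewrite ger0_norm ?subr_ge0//; lra.
have h2 : expR (c * (0 - q)) <= 1 + c * (0 - q) + 2 * (c * (0 - q)) ^+ 2.
  apply: expR_le_quadratic; rewrite normrM (le_trans _ c1)// ler_piMr//.
  by rewrite sub0r normrN ger0_norm.
apply: le_trans (expR_ge1Dx _).
apply: le_trans (lerD (ler_wpM2l q0 h1) (ler_wpM2l _ h2)) _; first by lra.
have := sqr_ge0 c; set d := c ^+ 2 => d0.
rewrite [leLHS](_ : _ = 1 + 2 * d * (q * (1 - q))); last by rewrite /d; ring.
have q2 : q * (1 - q) <= 1 by nra.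
by rewrite lerD2l ler_piMr//; lra.
Qed.

Lemma Ex_expR_centered_sum p a l g : (forall e, 0 <= p e <= 1) -> uniq l ->
  (forall e, e \in l -> `|a e| <= 2^-1) ->
  Ex p l (fun h => expR (centered_sum p a l h)) g <=
  expR (2 * \sum_(e <- l) a e ^+ 2).
Proof.
move=> p01; elim: l g => [|e l IH] g /=.
  by move=> _ _; rewrite /centered_sum !big_nil mulr0.
move=> /andP[el ul] al.
have key c : Ex p l (fun h => expR (centered_sum p a (e :: l) h)) (upd g e c) =
    expR (a e * (c%:R - p e)) * Ex p l (fun h => expR (centered_sum p a l h)) (upd g e c).
  rewrite -ExZ; apply: Ex_eq => h hg.
  by rewrite (centered_sum_upd _ _ el hg) expRD.
have IH' c : Ex p l (fun h => expR (centered_sum p a l h)) (upd g e c) <=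
    expR (2 * \sum_(j <- l) a j ^+ 2).
  by apply: IH => // j jl; apply: al; rewrite in_cons jl orbT.
have /andP[p0 p1] := p01 e.
have eR : expR (2 * \sum_(j <- e :: l) a j ^+ 2) =
    expR (2 * a e ^+ 2) * expR (2 * \sum_(j <- l) a j ^+ 2).
  by rewrite big_cons mulrDr expRD.
rewrite eR !key [X in X + _]mulrA [X in _ + X]mulrA.
have ae : `|a e| <= 2^-1 by apply: al; rewrite mem_head.
have hb : p e * expR (a e * (true%:R - p e)) +
    (1 - p e) * expR (a e * (false%:R - p e)) <= expR (2 * a e ^+ 2).
  exact: bernoulli_mgf (p01 e) ae.
apply: (@le_trans _ _ ((p e * expR (a e * (true%:R - p e)) +
    (1 - p e) * expR (a e * (false%:R - p e))) *
    expR (2 * \sum_(j <- l) a j ^+ 2))); last first.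
  by rewrite ler_wpM2r ?expR_ge0.
rewrite [leRHS]mulrDl.
by rewrite lerD// ler_wpM2l// mulr_ge0 ?expR_ge0// subr_ge0.
Qed.

Lemma centered_sumZ p a l (th : R) h :
  centered_sum p (fun e => th * a e) l h = th * centered_sum p a l h.
Proof. by rewrite /centered_sum mulr_sumr; apply: eq_bigr => e _; rewrite mulrA. Qed.

(** Exponential Markov inequality for both signs: the indicator is dominated by
    [expR (- (th * lam))] times the sum of the exponentials of [th] and [- th] times the centred
    sum. *)
Lemma chernoff p a l g (th lam : R) : (forall e, 0 <= p e <= 1) -> uniq l ->
  0 < th -> (forall e, e \in l -> `|th * a e| <= 2^-1) ->
  Ex p l (fun h => (lam < `|centered_sum p a l h|)%R%:R) g <=
  2 * expR (2 * (th ^+ 2 * \sum_(e <- l) a e ^+ 2) - th * lam).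
Proof.
move=> p01 ul th0 al.
have one s : s = 1 \/ s = -1 ->
    Ex p l (fun h => expR (s * th * centered_sum p a l h)) g <=
    expR (2 * (th ^+ 2 * \sum_(e <- l) a e ^+ 2)).
  move=> s1; rewrite mulr_sumr.
  under Ex_eq do rewrite -centered_sumZ.
  apply: le_trans (Ex_expR_centered_sum _ p01 ul _) _.
    move=> e el; rewrite -mulrA normrM (_ : `|s| = 1) ?mul1r ?al//.
    by case: s1 => ->; rewrite ?normrN normr1.
  rewrite ler_expR ler_pM2l//; apply: ler_sum => e _.
  by rewrite !exprMn (_ : s ^+ 2 = 1) ?mul1r//; case: s1 => ->; rewrite ?sqrrN expr1n.
apply: (@le_trans _ _ (Ex p l (fun h =>
    expR (- (th * lam)) * (expR (1 * th * centered_sum p a l h) +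
                           expR (-1 * th * centered_sum p a l h))) g)).
  apply: Ex_le => // h; case: ltP => [lamS|_]; last first.
    by rewrite mulr_ge0 ?expR_ge0// addr_ge0 ?expR_ge0.
  rewrite mulrDr -!expRD.
  have [S0|S0] := leP 0 (centered_sum p a l h).
    rewrite -[leLHS]addr0 lerD ?expR_ge0//.
    rewrite -[leLHS]expR0 ler_expR mul1r addrC -mulrBr mulr_ge0 ?(ltW th0)//.
    by rewrite subr_ge0 -(ger0_norm S0) ltW.
  rewrite -[leLHS]add0r lerD ?expR_ge0//.
  rewrite -[leLHS]expR0 ler_expR mulNr mul1r -mulrN mulNr -mulrBr addrC.
  by rewrite mulr_ge0 ?(ltW th0)// subr_ge0 -(ltr0_norm S0) ltW.
rewrite ExZ ExD expRD [leRHS]mulrA [leRHS]mulrC ler_wpM2l ?expR_ge0//.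
by rewrite mulr_natl mulr2n lerD//; apply: one; [left|right].
Qed.

End bernoulli_product.

(** * Joint law of finitely many independent events *)

Section law_of_independent_events.
Context {R : realType} d (T : measurableType d) (P : probability T R).
Context {I : finType} (D : pred I) (A : I -> set T) (p : I -> R).
Hypothesis mA : forall i, measurable (A i).
Hypothesis PA : forall i, D i -> P (A i) = (p i)%:E.
Hypothesis indA : mutually_independent P D A.

(** The observed outcomes on [l], completed by [g] elsewhere, in accordance with the convention of
    [Ex]. *)
Definition config (l : seq I) (g : I -> bool) (w : T) : I -> bool :=
  fun i => if i \in l then `[< A i w >] else g i.

Lemma config_cons e l g w : e \notin l ->
  config (e :: l) g w = config l (upd g e `[< A e w >]) w.
Proof.
move=> el; apply/funext => i; rewrite /config in_cons /upd.
by have [->|] := eqVneq i e; rewrite ?(negbTE el).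
Qed.

Lemma config_event_cons e l g (B : (I -> bool) -> bool) : e \notin l ->
  [set w | B (config (e :: l) g w)] =
  A e `&` [set w | B (config l (upd g e true) w)] `|`
  ~` A e `&` [set w | B (config l (upd g e false) w)].
Proof.
move=> el; apply/seteqP; split => w /=; rewrite config_cons//.
- by have [Aw|Aw] := asboolP (A e w); [left|right].
- by case=> -[Aw]; rewrite ?(asboolT Aw) ?(asboolF Aw).
Qed.

Lemma measurable_config l g (B : (I -> bool) -> bool) : uniq l ->
  measurable [set w | B (config l g w)].
Proof.
elim: l g => [|e l IH] g /=.
  move=> _; have [Bg|Bg] := boolP (B g).
    by rewrite (_ : [set _ | _] = setT)//; apply/seteqP; split.
  by rewrite (_ : [set _ | _] = set0)//; apply/seteqP; split => //= w /(negP Bg).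
move=> /andP[el ul]; rewrite config_event_cons//.
apply: measurableU; apply: measurableI; [exact: mA|exact: IH| |exact: IH].
by apply: measurableC; exact: mA.
Qed.

(** Independence is given for intersections of the events themselves, hence the extra intersection
    over [J]. The part outside [A e] is a difference of two probabilities, one for [J] and one for
    [J] enlarged by [e], and both fall under the induction hypothesis. *)
Lemma probability_config_cond l g (B : (I -> bool) -> bool) (J : {set I}) :
  uniq l -> {subset l <= D} -> {subset J <= D} -> (forall i, i \in l -> i \notin J) ->
  P ((\bigcap_(i in [set` J]) A i) `&` [set w | B (config l g w)]) =
  ((\prod_(i in J) p i) * Ex p l (fun h => (B h)%:R) g)%:E.
Proof.
have PJ (K : {set I}) : {subset K <= D} ->
    P (\bigcap_(i in [set` K]) A i) = (\prod_(i in K) p i)%:E.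
  move=> KD; rewrite indA// -prodEFin.
  by apply: eq_bigr => i iK; rewrite PA//; exact: KD.
elim: l g J => [|e l IH] g J /=.
  move=> _ _ JD _; have [Bg|Bg] := boolP (B g).
    rewrite (_ : [set _ : T | true] = setT) ?setIT ?mulr1 ?PJ//.
    by apply/seteqP; split.
  rewrite (_ : [set _ : T | false] = set0) ?setI0 ?mulr0 ?measure0//.
  by apply/seteqP; split.
move=> /andP[el ul] lD JD lJ.
have De : D e by apply: lD; rewrite mem_head.
have eJ : e \notin J by apply: lJ; rewrite mem_head.
have lD' : {subset l <= D} by move=> i il; apply: lD; rewrite in_cons il orbT.
have lJ' i : i \in l -> i \notin J by move=> il; apply: lJ; rewrite in_cons il orbT.
have JeD : {subset (e |: J)%SET <= D}.
  by move=> i; rewrite !inE => /orP[/eqP ->//|]; exact: JD.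
have lJe i : i \in l -> i \notin (e |: J)%SET.
  move=> il; rewrite !inE negb_or lJ'// andbT.
  by apply: contraNneq el => <-.
have AJe : \bigcap_(i in [set` (e |: J)%SET]) A i = A e `&` \bigcap_(i in [set` J]) A i.
  apply/seteqP; split => w /= h.
    split; first by apply: h; rewrite /= !inE eqxx.
    by move=> i iJ; apply: h; rewrite /= !inE; move: iJ => /= ->; rewrite orbT.
  by move=> i /=; rewrite !inE => /orP[/eqP ->|iJ]; [exact: h.1|exact: h.2].
have mJ (K : {set I}) : measurable (\bigcap_(i in [set` K]) A i).
  by apply: fin_bigcap_measurable => //; exact: finite_finset.
have pJe : \prod_(i in (e |: J)%SET) p i = p e * \prod_(i in J) p i.
  by rewrite big_setU1.
rewrite config_event_cons// setIUr measureU; last 3 first.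
- apply: measurableI; first exact: mJ.
  by apply: measurableI => //; exact: measurable_config.
- apply: measurableI; first exact: mJ.
  by apply: measurableI; [exact: measurableC|exact: measurable_config].
- by rewrite setIACA [X in _ `&` X]setIACA setICr set0I setI0.
have h1 := IH (upd g e true) _ ul lD' JeD lJe.
have h2 := IH (upd g e false) _ ul lD' JeD lJe.
have h3 := IH (upd g e false) _ ul lD' JD lJ'.
rewrite AJe pJe in h1 h2.
rewrite [X in (X + _)%E](_ : _ =
    (p e * \prod_(i in J) p i * Ex p l (fun h => (B h)%:R) (upd g e true))%:E); last first.
  by rewrite -h1; congr (P _); rewrite setIA; congr (_ `&` _); rewrite setIC.
set X := (\bigcap_(i in [set` J]) A i) `&` [set w | B (config l (upd g e false) w)] in h3.
rewrite [X in (_ + X)%E](_ : _ = P (X `\` A e)); last first.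
  by congr (P _); rewrite /X setDE setIAC setIA.
have mX : measurable X by apply: measurableI => //; exact: measurable_config.
have -> : (P (X `\` A e) = P X - P (X `&` A e))%E.
  by rewrite measureD//; rewrite ltey_eq fin_num_measure.
have -> : X `&` A e = (A e `&` (\bigcap_(i in [set` J]) A i)) `&`
    [set w | B (config l (upd g e false) w)].
  by rewrite /X setIC setIA.
rewrite h3 h2 -EFinB -EFinD; congr (_%:E); ring.
Qed.

Lemma probability_config l g (B : (I -> bool) -> bool) :
  uniq l -> {subset l <= D} ->
  P [set w | B (config l g w)] = (Ex p l (fun h => (B h)%:R) g)%:E.
Proof.
move=> ul lD.
have := @probability_config_cond l g B finset.set0 ul lD.
rewrite big_set0 mul1r => <- => [|i|i _]; rewrite ?inE//.
rewrite [X in X `&` _](_ : _ = setT) ?setTI//.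
by apply/seteqP; split => // w _ i /=; rewrite inE.
Qed.

End law_of_independent_events.

(** * Normal distribution function and Lindeberg replacement *)

(** The derivative is required only between the endpoints, because the functions of time below are
    differentiated only at positive times. *)
Lemma MVT_closed (R : realType) (f df : R -> R) (a b : R) : a <= b ->
  (forall z, a <= z -> z <= b -> is_derive z 1 f (df z)) ->
  exists c, [/\ a <= c, c <= b & f b - f a = df c * (b - a)].
Proof.
move=> ab D.
have [z|t|c] := @MVT_segment R f df a b ab.
- by rewrite in_itv/= => /andP[/ltW h1 /ltW h2]; exact: D.
- move: t; apply: derivable_within_continuous => t.
  by rewrite in_itv/= => /andP[h1 h2]; have [] := D t h1 h2.
- by rewrite in_itv/= => /andP[h1 h2] e; exists c.
Qed.

Section normal_cdf.
Context {R : realType}.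
Implicit Types x y z w s : R.

Definition normal_cdf x : R := fine (normal_prob (0 : R) 1 `]-oo, x]).
Definition normal_density x : R := normal_pdf (0 : R) 1 x.

Lemma normal_cdfE x : (normal_cdf x)%:E = normal_prob (0 : R) 1 `]-oo, x].
Proof. by rewrite /normal_cdf fineK// fin_num_measure. Qed.

Lemma normal_cdf_ge0 x : 0 <= normal_cdf x.
Proof. by rewrite /normal_cdf fine_ge0. Qed.

Lemma normal_cdf_le1 x : normal_cdf x <= 1.
Proof. by rewrite -lee_fin normal_cdfE probability_le1. Qed.

Lemma normal_cdf_le x y : x <= y -> normal_cdf x <= normal_cdf y.
Proof.
move=> xy; rewrite -lee_fin !normal_cdfE le_measure ?inE//.
exact: subset_itvl.
Qed.

(** As a random variable under the normal law the identity has distribution function [normal_cdf];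
    this gives the limits at both infinities. *)
Let idR : measurableTypeR R -> R := idfun.

HB.instance Definition _ :=
  @isMeasurableFun.Build _ _ _ _ idR (@measurable_id _ _ setT).

Lemma normal_cdf_cvgy (e : R) : 0 < e ->
  exists M : R, forall x, M <= x -> 1 - e <= normal_cdf x.
Proof.
move=> e0.
have := @cvg_cdfy1 _ _ R (normal_prob (0 : R) 1) (idR : {RV _ >-> R}).
move=> /fine_cvgP[_] /cvgrPdist_le /(_ _ e0)[M [_ h]].
exists (M + 1) => x Mx.
have /h : M < x by apply: lt_le_trans Mx; rewrite ltrDl.
rewrite ler_distlC => /andP[+ _].
by rewrite /= /cdf /distribution /pushforward preimage_id.
Qed.

Lemma normal_cdf_cvgNy (e : R) : 0 < e ->
  exists M : R, forall x, x <= M -> normal_cdf x <= e.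
Proof.
move=> e0.
have := @cvg_cdfNy0 _ _ R (normal_prob (0 : R) 1) (idR : {RV _ >-> R}).
move=> /fine_cvgP[_] /cvgrPdist_le /(_ _ e0)[M [_ h]].
exists (M - 1) => x Mx.
have /h : x < M by apply: le_lt_trans Mx _; rewrite ltrBlDr ltrDl.
rewrite sub0r normrN => /(le_trans (ler_norm _)).
by rewrite /= /cdf /distribution /pushforward preimage_id.
Qed.

Lemma is_derive_normal_cdf x : is_derive x 1 normal_cdf (normal_density x).
Proof.
have int : (@lebesgue_measure R).-integrable `]-oo, x + 1] (EFin \o normal_density).
  apply: integrableS (integrable_normal_pdf _ _) => //.
have [] := @continuous_FTC1 R normal_density -oo%O x (x + 1) _ int _ _.
- by rewrite ltrDl.
- by rewrite ltNyr.
- by apply: continuous_normal_pdf; rewrite oner_eq0.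
rewrite derive1E => d1 d2.
exact: DeriveDef.
Qed.

Lemma normal_densityE x :
  normal_density x = normal_peak 1 * expR (- (x ^+ 2) / 2).
Proof. by rewrite /normal_density normal_pdfE// /normal_fun subr0 expr1n. Qed.

Lemma is_derive_normal_density x :
  is_derive x 1 normal_density (- x * normal_density x).
Proof.
rewrite (_ : normal_density = (fun x => normal_peak 1 * expR (- (x * x) / 2))); last first.
  by apply/funext => y; rewrite normal_densityE expr2.
have D1 : is_derive x 1 (fun y : R => - (y * y) / 2) (- x).
  have D := is_derive_fctM (is_derive_fct_cst (- 2^-1) x)
    (is_derive_fctM (is_derive_fct_id x) (is_derive_fct_id x)).
  rewrite (_ : (fun _ => _) = (fun y : R => - 2^-1 * (y * y))); last first.
    by apply/funext => y; field.
  by apply: (is_derive_eq D); field.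
have D2 := @is_derive_fct_comp _ expR _ x _ _ (is_derive_expR _) D1.
have D3 := is_derive_fctM (is_derive_fct_cst (normal_peak 1) x) D2.
by apply: (is_derive_eq D3); ring.
Qed.

Lemma normal_density_ge0 x : 0 <= normal_density x.
Proof. exact: normal_pdf_ge0. Qed.

(** From [expR y >= 1 + y^2 / 2] at [y = x^2 / 2] and a peak at most 1. This one estimate controls
    the density and its polynomial multiples in the derivative bounds below. *)
Lemma normal_density_moment x : (1 + x ^+ 4) * normal_density x <= 9.
Proof.
have peak1 : normal_peak (1 : R) <= 1.
  have pi2 : 1 <= 1 ^+ 2 * pi *+ 2 :> R.
    by have := @pi_ge2 R; rewrite expr1n mul1r mulr2n; lra.
  rewrite /normal_peak invf_le1 ?sqrtr_gt0 ?(lt_le_trans _ pi2)//.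
  by rewrite -[leLHS]sqrtr1 ler_wsqrtr.
have y0 : 0 <= x ^+ 2 / 2 by rewrite divr_ge0// sqr_ge0.
rewrite normal_densityE mulNr expRN.
have := expR_ge1Dxn 1 y0; set E := expR _ => hE.
have E0 : 0 < E by exact: expR_gt0.
have e2 : x ^+ 4 = 4 * (x ^+ 2 / 2) ^+ 2 by field.
rewrite mulrA ler_pdivrMr//.
have : (1 + x ^+ 4) * normal_peak 1 <= 1 + x ^+ 4.
  by rewrite ler_piMr// addr_ge0// e2 mulr_ge0// sqr_ge0.
move=> /le_trans; apply; rewrite e2; move: hE.
by rewrite (_ : 2`!%:R = 2 :> R)//; have := sqr_ge0 (x ^+ 2 / 2); lra.
Qed.

(** The second derivative of [normal_cdf]. *)
Definition normal_hess x : R := - x * normal_density x.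

Lemma is_derive_normal_hess x :
  is_derive x 1 normal_hess ((x ^+ 2 - 1) * normal_density x).
Proof.
rewrite (_ : normal_hess = (fun y => (-1 * y) * normal_density y)); last first.
  by apply/funext => y; rewrite /normal_hess mulN1r.
have D := is_derive_fctM (is_derive_fctM (is_derive_fct_cst (-1) x)
  (is_derive_fct_id x)) (is_derive_normal_density x).
by apply: (is_derive_eq D); ring.
Qed.

Lemma normal_hess_bound x : `|normal_hess x| <= 9.
Proof.
have := normal_density_moment x; have := normal_density_ge0 x.
rewrite /normal_hess; move: (normal_density x) => f f0.
rewrite (_ : x ^+ 4 = (x ^+ 2) ^+ 2); last by ring.
move=> h; rewrite normrM normrN (ger0_norm f0); apply: le_trans h.
rewrite ler_wpM2r// -[x ^+ 2]real_normK ?num_real//.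
have := normr_ge0 x; set t := `|x| => t0.
by have := sqr_ge0 (t ^+ 2 - 2^-1); have := sqr_ge0 (t - 2^-1); nra.
Qed.

Lemma normal_hess'_bound x : `|(x ^+ 2 - 1) * normal_density x| <= 18.
Proof.
have := normal_density_moment x; have := normal_density_ge0 x.
move: (normal_density x) => f f0.
rewrite (_ : x ^+ 4 = (x ^+ 2) ^+ 2); last by ring.
move=> h; rewrite normrM (ger0_norm f0).
apply: (@le_trans _ _ (2 * ((1 + (x ^+ 2) ^+ 2) * f))); last by lra.
rewrite mulrA ler_wpM2r// ler_norml; have := sqr_ge0 x.
by set t := x ^+ 2 => t0; apply/andP; split; have := sqr_ge0 (t - 1); nra.
Qed.

Lemma normal_hess'_bound1 x : `|x * ((x ^+ 2 - 1) * normal_density x)| <= 18.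
Proof.
have := normal_density_moment x; have := normal_density_ge0 x.
move: (normal_density x) => f f0.
rewrite (_ : x ^+ 4 = (x ^+ 2) ^+ 2); last by ring.
move=> h; rewrite mulrA normrM (ger0_norm f0).
apply: (@le_trans _ _ (2 * ((1 + (x ^+ 2) ^+ 2) * f))); last by lra.
rewrite mulrA ler_wpM2r// normrM -[x ^+ 2]real_normK ?num_real//.
have := normr_ge0 x; set t := `|x| => t0.
have h1 : `|t ^+ 2 - 1| <= t ^+ 2 + 1.
  by rewrite ler_norml; apply/andP; split; have := sqr_ge0 t; lra.
apply: le_trans (ler_wpM2l t0 h1) _.
have := sqr_ge0 (t ^+ 2 - t); have := sqr_ge0 (t - 1); have := sqr_ge0 (t^+2 - 1).
by have := sqr_ge0 (t ^+ 2); nra.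
Qed.

(** Two uses of the mean value theorem, first for [F] minus its Taylor polynomial, then for [F1].
    The constant [K] is not sharp. *)
Lemma taylor2 (F F1 F2 : R -> R) (K : R) y (h : R) :
  (forall z : R, is_derive z 1 F (F1 z)) -> (forall z : R, is_derive z 1 F1 (F2 z)) ->
  (forall u v, `|F2 u - F2 v| <= K * `|u - v|) ->
  `|F (y + h) - F y - F1 y * h - F2 y * (h ^+ 2 / 2)| <= K * `|h| ^+ 3.
Proof.
move=> D1 D2 L.
pose G z := F z - (F1 y * z + F2 y * ((z - y) * (z - y) / 2)).
have DG z : is_derive z 1 G (F1 z - (F1 y + F2 y * (z - y))).
  have Dz := is_derive_fctB (is_derive_fct_id z) (is_derive_fct_cst y z).
  have D3 := is_derive_fctB (D1 z) (is_derive_fctD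
    (is_derive_fctM (is_derive_fct_cst (F1 y) z) (is_derive_fct_id z))
    (is_derive_fctM (is_derive_fct_cst (F2 y) z)
      (is_derive_fctM (is_derive_fctM Dz Dz) (is_derive_fct_cst 2^-1 z)))).
  by apply: (is_derive_eq D3); field.
have [c cy e] := MVT_two_points y (y + h) DG.
have -> : F (y + h) - F y - F1 y * h - F2 y * (h ^+ 2 / 2) = G (y + h) - G y.
  by rewrite /G; field.
rewrite e [y + h - y]addrAC subrr add0r normrM.
rewrite [y + h - y]addrAC subrr add0r in cy.
have [c' cy' e'] := MVT_two_points y c D2.
have -> : F1 c - (F1 y + F2 y * (c - y)) = (F2 c' - F2 y) * (c - y).
  by rewrite mulrBl -e'; ring.
rewrite (_ : K * `|h| ^+ 3 = (K * `|h|) * `|h| * `|h|); last by ring.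
rewrite ler_wpM2r// normrM ler_pM//.
apply: le_trans (L _ _) _.
have K0 : 0 <= K.
  by have := le_trans (normr_ge0 _) (L 1 0); rewrite subr0 normr1 mulr1.
by rewrite ler_wpM2l// (le_trans cy').
Qed.

(** * Heat equation for the normal distribution function *)

Definition inv_sqrt s : R := (Num.sqrt s)^-1.

Lemma inv_sqrt_gt0 s : 0 < s -> 0 < inv_sqrt s.
Proof. by move=> s0; rewrite invr_gt0 sqrtr_gt0. Qed.

Lemma inv_sqrt_le s t : 0 < s -> s <= t -> inv_sqrt t <= inv_sqrt s.
Proof.
move=> s0 st; rewrite lef_pV2 ?posrE ?sqrtr_gt0 ?ler_wsqrtr//.
exact: lt_le_trans st.
Qed.

Lemma is_derive_inv_sqrt s : 0 < s ->
  is_derive s 1 inv_sqrt (- 2^-1 * inv_sqrt s ^+ 3).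
Proof.
move=> s0; have q0 : Num.sqrt s != 0 by rewrite gt_eqF// sqrtr_gt0.
have D := @is_deriveV _ (fun x => Num.sqrt x) _ _ _ q0 (is_derive1_sqrt s0).
apply: (is_derive_eq D); rewrite /GRing.scale/= /inv_sqrt.
by field.
Qed.

(* (s, w) |-> normal_cdf (w * inv_sqrt s) solves the heat equation
   d_s u = d_ww u / 2. *)
Lemma is_derive_heat_time w s : 0 < s ->
  is_derive s 1 (fun t => normal_cdf (w * inv_sqrt t))
    (2^-1 * inv_sqrt s ^+ 2 * normal_hess (w * inv_sqrt s)).
Proof.
move=> s0.
have D := is_derive_fctM (is_derive_fct_cst w s) (is_derive_inv_sqrt s0).
have D2 := @is_derive_fct_comp _ normal_cdf _ s _ _ (is_derive_normal_cdf _) D.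
by apply: (is_derive_eq D2); rewrite /normal_hess; field.
Qed.

Lemma is_derive_heat_time2 w s : 0 < s ->
  is_derive s 1
    (fun t => 2^-1 * (inv_sqrt t * inv_sqrt t) * normal_hess (w * inv_sqrt t))
    (- 2^-1 * inv_sqrt s ^+ 4 * (normal_hess (w * inv_sqrt s) +
       2^-1 * (w * inv_sqrt s *
        (((w * inv_sqrt s) ^+ 2 - 1) * normal_density (w * inv_sqrt s))))).
Proof.
move=> s0.
have Dk := is_derive_inv_sqrt s0.
have D := is_derive_fctM (is_derive_fct_cst w s) Dk.
have D2 := @is_derive_fct_comp _ normal_hess _ s _ _ (is_derive_normal_hess _) D.
have D3 := is_derive_fctM (is_derive_fctM (is_derive_fct_cst 2^-1 s)
  (is_derive_fctM Dk Dk)) D2.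
by apply: (is_derive_eq D3); field.
Qed.

(** First-order expansion in time. The second time derivative is at most
    [2^-1 * inv_sqrt eta ^+ 4 * 18], as [eta] keeps the time away from 0. *)
Lemma heat_time_step w s s' (eta : R) : 0 < eta -> eta <= s' -> s' <= s ->
  `|normal_cdf (w * inv_sqrt s) - normal_cdf (w * inv_sqrt s') -
    2^-1 * inv_sqrt s' ^+ 2 * normal_hess (w * inv_sqrt s') * (s - s')| <=
  9 * inv_sqrt eta ^+ 4 * (s - s') ^+ 2.
Proof.
move=> eta0 es s's.
have pos t : s' <= t -> 0 < t by move=> h; rewrite (lt_le_trans eta0)// (le_trans es).
have [c [c1 c2 ->]] := MVT_closed s's
  (fun t h _ => is_derive_heat_time w (pos t h)).
rewrite -mulrBl normrM [`|s - s'|]ger0_norm ?subr_ge0//.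
rewrite [leRHS](_ : _ = 9 * inv_sqrt eta ^+ 4 * (s - s') * (s - s')); last by ring.
rewrite ler_wpM2r ?subr_ge0//.
have [c' [c1' c2' e]] := MVT_closed c1
  (fun t h _ => is_derive_heat_time2 w (pos t h)).
rewrite !expr2 e normrM [`|c - s'|]ger0_norm ?subr_ge0//.
apply: ler_pM; [exact: normr_ge0|by rewrite subr_ge0| |by rewrite lerD2r].
set y := w * inv_sqrt c'.
have k0 : 0 < inv_sqrt c' by rewrite inv_sqrt_gt0// pos.
have k1 : inv_sqrt c' <= inv_sqrt eta by rewrite inv_sqrt_le// (le_trans es).
rewrite normrM [`|_ * _ ^+ 4|]normrM normrN (ger0_norm (ltW (exprn_gt0 4 k0))).
rewrite [`|2^-1|]ger0_norm//.
have h1 : `|normal_hess y + 2^-1 * (y * ((y ^+ 2 - 1) * normal_density y))| <= 18.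
  apply: le_trans (ler_normD _ _) _.
  have := normal_hess_bound y; have := normal_hess'_bound1 y.
  by rewrite [`|2^-1 * _|]normrM [`|2^-1|]ger0_norm//; lra.
have h2 : inv_sqrt c' ^+ 4 <= inv_sqrt eta ^+ 4.
  by rewrite lerXn2r// nnegrE ltW// inv_sqrt_gt0.
have h3 := ler_pM (ltW (exprn_gt0 4 k0)) (normr_ge0 _) h2 h1.
rewrite -[leLHS]mulrA (_ : 9 * inv_sqrt eta ^+ 4 = 2^-1 * (inv_sqrt eta ^+ 4 * 18)).
  by rewrite ler_pM2l.
by field.
Qed.

(** A second-order expansion averaged over a centred Bernoulli variable: the first-order terms
    cancel and the second-order ones produce the variance. *)
Lemma heat_space_step (q k a w : R) : 0 <= q <= 1 -> 0 <= k ->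
  `|q * normal_cdf ((w - a * (1 - q)) * k) +
    (1 - q) * normal_cdf ((w - a * (0 - q)) * k) - normal_cdf (w * k) -
    2^-1 * k ^+ 2 * normal_hess (w * k) * (q * (1 - q) * a ^+ 2)| <=
  18 * k ^+ 3 * `|a| ^+ 3.
Proof.
move=> /andP[q0 q1] k0.
have L u v : `|normal_hess u - normal_hess v| <= 18 * `|u - v|.
  apply: (Lipschitz_derive _ _ is_derive_normal_hess) => z.
  exact: normal_hess'_bound.
have T h := taylor2 (w * k) h is_derive_normal_cdf is_derive_normal_density L.
have T1 := T (- (a * (1 - q) * k)); have T2 := T (a * q * k).
rewrite (_ : (w - a * (1 - q)) * k = w * k + - (a * (1 - q) * k)); last by ring.
rewrite (_ : (w - a * (0 - q)) * k = w * k + a * q * k); last by ring.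
set A := _ - _ - _ - _ in T1; set B := _ - _ - _ - _ in T2.
rewrite [X in `|X|](_ : _ = q * A + (1 - q) * B); last by rewrite /A /B /normal_hess; field.
have q1' : 0 <= 1 - q by lra.
apply: le_trans (ler_normD _ _) _; rewrite !normrM (ger0_norm q0) (ger0_norm q1').
have K3 : 0 <= `|a| ^+ 3 * k ^+ 3 by rewrite mulr_ge0// exprn_ge0.
have b1 : `|- (a * (1 - q) * k)| ^+ 3 <= `|a| ^+ 3 * k ^+ 3.
  rewrite normrN !normrM (ger0_norm k0) (ger0_norm q1') mulrAC exprMn.
  rewrite exprMn ler_piMr// exprn_ile1//; lra.
have b2 : `|a * q * k| ^+ 3 <= `|a| ^+ 3 * k ^+ 3.
  rewrite !normrM (ger0_norm k0) (ger0_norm q0) mulrAC exprMn.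
  by rewrite exprMn ler_piMr// exprn_ile1.
by nra.
Qed.

(** By the heat equation the variance term of the space step equals the linear term of the time
    step, so only remainders survive; [|a| <= 1] turns the fourth power from the time step into a
    third one. *)
Lemma heat_step (q a w s s' eta : R) : 0 <= q <= 1 -> `|a| <= 1 -> 0 < eta ->
  eta <= s' -> s = s' + q * (1 - q) * a ^+ 2 ->
  `|q * normal_cdf ((w - a * (1 - q)) * inv_sqrt s') +
    (1 - q) * normal_cdf ((w - a * (0 - q)) * inv_sqrt s') -
    normal_cdf (w * inv_sqrt s)| <=
  (18 * inv_sqrt eta ^+ 3 + 9 * inv_sqrt eta ^+ 4) * `|a| ^+ 3.
Proof.
move=> /andP[q0 q1] a1 eta0 es ->.
set sg := q * (1 - q) * a ^+ 2.
have sg0 : 0 <= sg by apply: mulr_ge0 (sqr_ge0 a); apply: mulr_ge0 => //; lra.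
have q2 : q * (1 - q) <= 1 by nra.
have sg1 : sg <= a ^+ 2 by rewrite /sg ler_piMl ?sqr_ge0.
have k0 := ltW (inv_sqrt_gt0 (lt_le_trans eta0 es)).
have k1 := inv_sqrt_le eta0 es.
have H1 := @heat_space_step q (inv_sqrt s') a w.
have {}H1 := H1 (introT andP (conj q0 q1)) k0.
have := @heat_time_step w (s' + sg) s' eta eta0 es.
rewrite lerDl [s' + sg - s']addrAC subrr add0r => /(_ sg0) H2.
have e (A B C D : R) : A - B = (A - C - D) - (B - C - D) by ring.
rewrite [X in `|X|](e _ _ (normal_cdf (w * inv_sqrt s'))
  (2^-1 * inv_sqrt s' ^+ 2 * normal_hess (w * inv_sqrt s') * sg)).
apply: le_trans (ler_normB _ _) _.
rewrite [leRHS]mulrDl lerD//.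
  apply: le_trans H1 _; rewrite ler_wpM2r ?exprn_ge0//.
  by rewrite ler_pM2l// lerXn2r// nnegrE// (le_trans k0).
apply: le_trans H2 _; apply: ler_wpM2l.
  by apply: mulr_ge0 => //; apply: exprn_ge0; exact: le_trans k0 k1.
apply: (@le_trans _ _ ((a ^+ 2) ^+ 2)); first by rewrite lerXn2r ?nnegrE ?sqr_ge0.
rewrite -[a ^+ 2]real_normK ?num_real//.
rewrite (_ : (`|a| ^+ 2) ^+ 2 = `|a| ^+ 3 * `|a|); last by ring.
by rewrite ler_piMr.
Qed.

(** * Lindeberg replacement *)

Lemma mix_mul_le (q A1 A0 A Q : R) : 0 <= Q <= 1 ->
  `|q * (A1 * Q) + (1 - q) * (A0 * Q) - A * Q| <= `|q * A1 + (1 - q) * A0 - A|.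
Proof.
move=> /andP[Q0 Q1]; rewrite !mulrA -mulrDl -mulrBl normrM (ger0_norm Q0).
exact: ler_piMr.
Qed.

Lemma mix_triangle (q X1 X0 Y1 Y0 Y D1 D2 : R) : 0 <= q <= 1 ->
  `|q * Y1 + (1 - q) * Y0 - Y| <= D1 -> `|X1 - Y1| <= D2 -> `|X0 - Y0| <= D2 ->
  `|q * X1 + (1 - q) * X0 - Y| <= D1 + D2.
Proof.
move=> /andP[q0 q1] H H1 H0.
have -> : q * X1 + (1 - q) * X0 - Y = (q * Y1 + (1 - q) * Y0 - Y) +
    (q * (X1 - Y1) + (1 - q) * (X0 - Y0)) by ring.
apply: le_trans (ler_normD _ _) (lerD H _).
apply: le_trans (ler_normD _ _) _; rewrite !normrM (ger0_norm q0).
have q0' : 0 <= 1 - q by rewrite subr_ge0.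
rewrite [`|1 - q|]ger0_norm//.
by have := ler_wpM2l q0 H1; have := ler_wpM2l q0' H0; lra.
Qed.

(** Each [e] influences at most one coordinate [j0], so the other factors form a common multiplier
    in [0, 1] and one [heat_step] applies. The time of coordinate [j] falls from [s j] by the
    variances met, and [eta] bounds its final value from below. *)
Lemma lindeberg (I : eqType) (J : finType) (p : I -> R) (a : J -> I -> R)
    (eta : R) (l : seq I) (w s : J -> R) (g : I -> bool) :
  (forall e, 0 <= p e <= 1) -> 0 < eta -> uniq l ->
  (forall e, e \in l -> exists j0, forall j, j != j0 -> a j e = 0) ->
  (forall j e, e \in l -> `|a j e| <= 1) ->
  (forall j, eta <= s j - \sum_(e <- l) p e * (1 - p e) * a j e ^+ 2) ->
  `|Ex p l (fun h => \prod_j normal_cdf ((w j - centered_sum p (a j) l h) *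
        inv_sqrt (s j - \sum_(e <- l) p e * (1 - p e) * a j e ^+ 2))) g -
    \prod_j normal_cdf (w j * inv_sqrt (s j))| <=
  (18 * inv_sqrt eta ^+ 3 + 9 * inv_sqrt eta ^+ 4) *
    \sum_(e <- l) \sum_j `|a j e| ^+ 3.
Proof.
move=> p01 eta0; set C := 18 * _ + _.
elim: l w s g => [|e l IH] w s g.
  move=> _ _ _ _; rewrite big_nil mulr0 normr_le0 subr_eq0; apply/eqP.
  by apply: eq_bigr => j _; rewrite /centered_sum !big_nil !subr0.
rewrite cons_uniq => /andP[el ul] disj a1 hs.
(* Position and time once [e] has been revealed with value [c]. *)
pose w' c j := w j - a j e * (c - p e).
pose s' j := s j - p e * (1 - p e) * a j e ^+ 2.
have s's j : s j - \sum_(e <- e :: l) p e * (1 - p e) * a j e ^+ 2 =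
    s' j - \sum_(e <- l) p e * (1 - p e) * a j e ^+ 2.
  by rewrite big_cons opprD addrA.
have sl j : 0 <= \sum_(e <- l) p e * (1 - p e) * a j e ^+ 2.
  apply: sumr_ge0 => i _; have /andP[p0 p1] := p01 i.
  by apply: mulr_ge0 (sqr_ge0 _); rewrite mulr_ge0// subr_ge0.
have IHc (c : bool) : `|Ex p l (fun h => \prod_j normal_cdf
      ((w j - centered_sum p (a j) (e :: l) h) *
        inv_sqrt (s j - \sum_(e <- e :: l) p e * (1 - p e) * a j e ^+ 2))) (upd g e c) -
    \prod_j normal_cdf (w' c%:R j * inv_sqrt (s' j))| <=
    C * \sum_(e <- l) \sum_j `|a j e| ^+ 3.
  rewrite (@Ex_eq _ _ _ _ _ (fun h => \prod_j normal_cdf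
      ((w' c%:R j - centered_sum p (a j) l h) *
        inv_sqrt (s' j - \sum_(e <- l) p e * (1 - p e) * a j e ^+ 2)))); last first.
    move=> h hg; apply: eq_bigr => j _.
    by rewrite s's (centered_sum_upd _ _ el hg) opprD addrA.
  apply: IH => //.
  - by move=> i il; apply: disj; rewrite in_cons il orbT.
  - by move=> j i il; apply: a1; rewrite in_cons il orbT.
  - by move=> j; rewrite -s's.
have [j0 hj0] := disj e (mem_head _ _).
pose Q : R := \prod_(j | j != j0) normal_cdf (w j * inv_sqrt (s j)).
have restw : \prod_j normal_cdf (w j * inv_sqrt (s j)) =
    normal_cdf (w j0 * inv_sqrt (s j0)) * Q by rewrite (bigD1 j0).
have rest c : \prod_j normal_cdf (w' c j * inv_sqrt (s' j)) =
    normal_cdf (w' c j0 * inv_sqrt (s' j0)) * Q.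
  rewrite [LHS](bigD1 j0 isT); congr (_ * _); apply: eq_bigr => j /hj0 aj.
  by rewrite /w' /s' aj mul0r expr0n mulr0 !subr0.
have Q01 : 0 <= Q <= 1.
  apply/andP; split; first by apply: prodr_ge0 => j _; exact: normal_cdf_ge0.
  by apply: prodr_ile1 => j _; rewrite normal_cdf_ge0 normal_cdf_le1.
have C0 : 0 <= C.
  by apply: addr_ge0; apply: mulr_ge0 => //; apply: exprn_ge0; apply: ltW;
    exact: inv_sqrt_gt0.
have step : `|p e * \prod_j normal_cdf (w' 1 j * inv_sqrt (s' j)) +
    (1 - p e) * \prod_j normal_cdf (w' 0 j * inv_sqrt (s' j)) -
    \prod_j normal_cdf (w j * inv_sqrt (s j))| <= C * \sum_j `|a j e| ^+ 3.
  rewrite (rest 1) (rest 0) restw.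
  apply: le_trans (mix_mul_le _ _ _ _ Q01) _.
  apply: (@le_trans _ _ (C * `|a j0 e| ^+ 3)).
    apply: (@heat_step (p e) (a j0 e) (w j0) (s j0) (s' j0) eta (p01 e)) => //.
    - by apply: a1; rewrite mem_head.
    - by have := hs j0; rewrite s's; have := sl j0; move: (\sum_(_ <- l) _) => z; lra.
    - by rewrite /s' subrK.
  apply: ler_wpM2l C0 _ _ _; rewrite (bigD1 j0)//= lerDl.
  by apply: sumr_ge0 => j _; exact: exprn_ge0.
rewrite big_cons [C * _]mulrDr.
exact: mix_triangle (p01 e) step (IHc true) (IHc false).
Qed.

End normal_cdf.

(** * Concentration of the degrees *)

Section edges.
Context {R : realType} {n : nat}.
Implicit Types (i j k : 'I_n) (e : 'I_n * 'I_n).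

Definition edges : seq ('I_n * 'I_n) :=
  [seq e : 'I_n * 'I_n <- enum {: 'I_n * 'I_n} | (e.1 < e.2)%N].

Definition edge_of i j : 'I_n * 'I_n := if (i < j)%N then (i, j) else (j, i).

Lemma edges_uniq : uniq edges.
Proof. by rewrite filter_uniq// enum_uniq. Qed.

Lemma mem_edges e : (e \in edges) = (e.1 < e.2)%N.
Proof. by rewrite mem_filter mem_enum andbT. Qed.

Lemma big_edges (F : 'I_n * 'I_n -> R) :
  \sum_(e <- edges) F e = \sum_(i < n) \sum_(j < n | (i < j)%N) F (i, j).
Proof.
rewrite /edges big_filter big_enum_cond/= pair_big_dep/=.
by apply: eq_big => -[i j].
Qed.

(** Double counting. It turns a linear combination of degrees into a sum over independent edges, an
    edge receiving the weights of its two ends. *)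
Lemma sum_edges (c : 'I_n -> R) (F : 'I_n * 'I_n -> R) :
  \sum_(e <- edges) (c e.1 + c e.2) * F e =
  \sum_i c i * \sum_(j | j != i) F (edge_of i j).
Proof.
rewrite big_edges/=.
under eq_bigr do under eq_bigr do rewrite mulrDl.
under eq_bigr do rewrite big_split/=.
rewrite big_split/= [X in _ + X](exchange_big_dep predT)//= -big_split/=.
apply: eq_bigr => i _; rewrite mulr_sumr [RHS](bigID (fun j => (i < j)%N))/=.
congr (_ + _); apply: eq_big => j.
- by rewrite neq_ltn; case: ltngtP.
- by rewrite /edge_of => ->.
- by rewrite neq_ltn; case: ltngtP.
- by move=> ji; rewrite /edge_of ltnNge (ltnW ji).
Qed.

End edges.

Section concentration.
Context {R : realType} {n : nat} (b : 'I_n -> R).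
Implicit Types (i j k : 'I_n) (e : 'I_n * 'I_n) (h : 'I_n * 'I_n -> bool).

Definition edge_p e : R := logistic (b e.1 + b e.2).

Definition deg h i : R := \sum_(j | j != i) (h (edge_of i j))%:R.

Definition deg_dev h i : R :=
  \sum_(j | j != i) ((h (edge_of i j))%:R - edge_p (edge_of i j)).

(** Up to sign, the sums bounded by [H] in [mle_expansion]. *)
Definition weighted_dev h i : R :=
  \sum_(j | j != i) logistic_var (b i + b j) / fisher_diag b j * deg_dev h j.

Lemma edge_p01 e : 0 <= edge_p e <= 1.
Proof. by rewrite !ltW ?logistic_gt0 ?logistic_lt1. Qed.

Lemma edge_p_edge_of i j : edge_p (edge_of i j) = logistic (b i + b j).
Proof. by rewrite /edge_p /edge_of; case: ifP => //= _; rewrite addrC. Qed.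

Lemma score_deg h i : score (deg h) b i = - deg_dev h i.
Proof.
rewrite /score /deg_dev sumrB opprB; congr (_ - _).
by apply: eq_bigr => j _; rewrite edge_p_edge_of.
Qed.

Lemma centered_sum_edges (c : 'I_n -> R) h :
  centered_sum edge_p (fun e => c e.1 + c e.2) edges h = \sum_i c i * deg_dev h i.
Proof. by rewrite /centered_sum sum_edges. Qed.

Definition vertex_weight i e : R := (e.1 == i)%:R + (e.2 == i)%:R.

Definition neighbour_weight i e : R :=
  (if e.1 == i then 0 else logistic_var (b i + b e.1) / fisher_diag b e.1) +
  (if e.2 == i then 0 else logistic_var (b i + b e.2) / fisher_diag b e.2).

Lemma deg_devE h i : deg_dev h i = centered_sum edge_p (vertex_weight i) edges h.
Proof.
rewrite (centered_sum_edges (fun j => (j == i)%:R)) (bigD1 i)//= eqxx mul1r.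
by rewrite big1 ?addr0// => j /negbTE ->; rewrite mul0r.
Qed.

Lemma weighted_devE h i :
  weighted_dev h i = centered_sum edge_p (neighbour_weight i) edges h.
Proof.
rewrite (centered_sum_edges (fun j => if j == i then 0 else
  logistic_var (b i + b j) / fisher_diag b j)) [RHS](bigD1 i)//= eqxx mul0r add0r.
by apply: eq_bigr => j /negbTE ->.
Qed.

Lemma vertex_weight_le1 i e : (e.1 < e.2)%N -> `|vertex_weight i e| <= 1.
Proof.
rewrite /vertex_weight => e12.
have [e1|_] := eqVneq e.1 i; have [e2|_] := eqVneq e.2 i;
  rewrite ?addr0 ?add0r ?normr0 ?normr1//.
by move: e12; rewrite e1 e2 ltnn.
Qed.

Lemma vertex_weight_sqr i :
  \sum_(e <- edges) vertex_weight i e ^+ 2 <= n%:R.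
Proof.
rewrite (eq_bigr (fun e => ((e.1 == i)%:R + (e.2 == i)%:R) * vertex_weight i e)); last first.
  by move=> e _; rewrite expr2.
rewrite (sum_edges (fun j => (j == i)%:R)) (bigD1 i)//= eqxx mul1r.
rewrite [X in _ + X]big1 ?addr0; last by move=> j /negbTE ->; rewrite mul0r.
apply: (@le_trans _ _ (\sum_(j | j != i) (1 : R))); last first.
  by rewrite sum_ord_neq_cst mulr1 gerBl.
apply: ler_sum => j /negbTE ji; rewrite /vertex_weight /edge_of.
by case: ifP => _ /=; rewrite eqxx ji ?addr0 ?add0r.
Qed.

Lemma fisher_diag_ge (m : R) i :
  (forall u v, m <= logistic_var (b u + b v)) -> (n%:R - 1) * m <= fisher_diag b i.
Proof. by move=> mv; rewrite -(sum_ord_neq_cst i) ler_sum. Qed.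

Lemma fisher_diag_le i : fisher_diag b i <= n%:R.
Proof.
apply: (@le_trans _ _ (\sum_(j | j != i) (1 : R))); last first.
  by rewrite sum_ord_neq_cst mulr1 gerBl.
by apply: ler_sum => j _; exact: logistic_var_le1.
Qed.

Lemma neighbour_weight_le (m : R) i e : (1 < n)%N -> 0 < m ->
  (forall u v, m <= logistic_var (b u + b v)) ->
  `|neighbour_weight i e| <= 2 / ((n%:R - 1) * m).
Proof.
move=> n1 m0 mv.
have nm0 : 0 < (n%:R - 1) * m by rewrite mulr_gt0// subr_gt0 ltr1n.
have one j : `|if j == i then 0 else logistic_var (b i + b j) / fisher_diag b j| <=
    1 / ((n%:R - 1) * m).
  case: ifP => _; first by rewrite normr0 divr_ge0// ltW.
  have D0 := lt_le_trans nm0 (fisher_diag_ge j mv).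
  rewrite ger0_norm; last by rewrite divr_ge0 ?ltW ?logistic_var_gt0.
  apply: ler_pM; [exact/ltW/logistic_var_gt0|by rewrite invr_ge0 ltW|
    exact: logistic_var_le1|].
  by rewrite lef_pV2 ?posrE// fisher_diag_ge.
apply: le_trans (ler_normD _ _) _.
apply: le_trans (lerD (one e.1) (one e.2)) _.
by rewrite -mulrDl.
Qed.

Definition bad (G H : R) h : bool :=
  [exists i, (G < `|deg_dev h i|) || (H < `|weighted_dev h i|)].

(** The thresholds make the Chernoff exponent at most [- 2 ln n] for each of the [2 n] deviations:
    each is exceeded with probability at most [2 / n^2], and the union bound gives [4 / n]. *)
Lemma Ex_bad (m : R) (g : 'I_n * 'I_n -> bool) : (1 < n)%N -> 0 < m ->
  (forall u v, m <= logistic_var (b u + b v)) ->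
  0 < ln n%:R :> R -> ln n%:R / n%:R <= 4^-1 :> R ->
  2 / ((n%:R - 1) * m) <= 2^-1 ->
  Ex edge_p edges
    (fun h => (bad (4 * Num.sqrt (n%:R * ln n%:R)) (2 * ln n%:R + 32 / m ^+ 2) h)%:R) g
  <= 4 / n%:R.
Proof.
move=> n1 m0 mv ln0 lnn nm.
set q : R := ln n%:R; set G := 4 * _; set H := _ + _.
have n0 : 0 < n%:R :> R by rewrite ltr0n ltnW.
have en : expR (- (2 * q)) = n%:R^-1 * n%:R^-1.
  rewrite (_ : - (2 * q) = - q + - q); last by ring.
  by rewrite expRD expRN /q lnK.
apply: (@le_trans _ _ (Ex edge_p edges (fun h => \sum_(i < n)
    ((G < `|deg_dev h i|)%R%:R + (H < `|weighted_dev h i|)%R%:R)) g)).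
  apply: Ex_le; first exact: edge_p01.
  move=> h; have [/existsP[i hi]|_] := boolP (bad G H h); last first.
    by apply: sumr_ge0 => i _; rewrite addr_ge0.
  rewrite (bigD1 i)//=; apply: ler_wpDr.
    by apply: sumr_ge0 => j _; rewrite addr_ge0.
  by case/orP: hi => ->; [rewrite lerDl|rewrite lerDr].
rewrite Ex_sum; apply: (@le_trans _ _ (\sum_(i < n) (4 * (n%:R^-1 * n%:R^-1)))); last first.
  rewrite sumr_const card_ord -mulr_natl le_eqVlt; apply/orP; left.
  by apply/eqP; field; rewrite gt_eqF.
apply: ler_sum => i _; rewrite ExD.
have -> : 4 * (n%:R^-1 * n%:R^-1) = 2 * expR (- (2 * q)) + 2 * expR (- (2 * q)) :> R.
  by rewrite en; ring.
apply: lerD.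
(* With this choice [th * G = 4 q], while the squared weights, of sum at most [n], contribute at
   most [2 q] to the exponent. *)
- pose th := Num.sqrt (q / n%:R).
  have th0 : 0 < th by rewrite sqrtr_gt0 divr_gt0.
  have th2 : th ^+ 2 = q / n%:R by rewrite sqr_sqrtr// ltW// divr_gt0.
  have thG : th * G = 4 * q.
    rewrite /G mulrCA -sqrtrM ?divr_ge0 ?ltW//; congr (_ * _).
    rewrite [X in Num.sqrt X](_ : _ = q ^+ 2) ?sqrtr_sqr ?gtr0_norm//.
    by field; rewrite gt_eqF.
  under Ex_eq do rewrite deg_devE.
  apply: le_trans (chernoff _ _ edge_p01 edges_uniq th0 _) _.
    move=> e; rewrite mem_edges => e12; rewrite normrM gtr0_norm//.
    have th1 : th <= 2^-1.
      rewrite -(@ler_pXn2r _ 2)//; try by rewrite nnegrE ltW.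
      by rewrite th2 -/q; move: lnn; rewrite -/q; lra.
    apply: (le_trans _ th1); rewrite ler_piMr ?(ltW th0)//.
    exact: vertex_weight_le1.
  rewrite ler_pM2l// ler_expR thG th2.
  have := ler_wpM2l (ltW (divr_gt0 ln0 n0)) (vertex_weight_sqr i).
  rewrite -/q divfK ?gt_eqF// => h; lra.
- under Ex_eq do rewrite weighted_devE.
  have nw e := neighbour_weight_le i e n1 m0 mv.
  apply: le_trans (chernoff _ _ edge_p01 edges_uniq ltr01 _) _.
    by move=> e _; rewrite mul1r (le_trans (nw e)).
  rewrite ler_pM2l// ler_expR expr1n !mul1r /H.
  have n1R : 0 < n%:R - 1 :> R by rewrite subr_gt0 ltr1n.
  (* At most [n^2] edges, each weight being at most [2 / ((n - 1) m)], and [n / (n - 1) <= 2]. *)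
  suff : \sum_(e <- edges) neighbour_weight i e ^+ 2 <= 16 / m ^+ 2 by lra.
  apply: (@le_trans _ _ (\sum_(e <- edges) (2 / ((n%:R - 1) * m)) ^+ 2)).
    apply: ler_sum => e _; rewrite -[leLHS]real_normK ?num_real// lerXn2r//.
      by rewrite nnegrE divr_ge0// mulr_ge0// ltW.
  rewrite big_edges.
  apply: (@le_trans _ _ (\sum_(j < n) \sum_(k < n) (2 / ((n%:R - 1) * m)) ^+ 2)).
    apply: ler_sum => j _; rewrite [leRHS](bigID (fun k : 'I_n => (j < k)%N))/=.
    by rewrite lerDl sumr_ge0// => k _; exact: sqr_ge0.
  have cst (x : R) : \sum_(j < n) x = n%:R * x.
    by rewrite sumr_const card_ord mulr_natl.
  rewrite !cst.
  rewrite [leLHS](_ : _ = (n%:R / (n%:R - 1)) ^+ 2 * (4 / m ^+ 2)); last first.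
    by field; rewrite !gt_eqF.
  rewrite (_ : 16 / m ^+ 2 = 2 ^+ 2 * (4 / m ^+ 2)); last by field; rewrite gt_eqF.
  apply: ler_wpM2r; first by apply: divr_ge0 => //; apply: exprn_ge0; exact: ltW.
  have n2R : 2 <= n%:R :> R by rewrite ler_nat.
  have r2 : n%:R / (n%:R - 1) <= 2 :> R by rewrite ler_pdivrMr//; lra.
  by rewrite lerXn2r// nnegrE ?divr_ge0 ?(ltW n0) ?(ltW n1R).
Qed.

(** The deterministic part: off the bad event, [mle_exists] is used on the box of radius 1, and the
    sup-norm bound it returns becomes the [rho] of [mle_expansion]. *)
Lemma good_expansion (m K G H : R) h :
  (2 < n)%N -> 0 < m <= 1 -> 0 <= G -> 0 <= H ->
  (forall i, `|b i| <= K) ->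
  (forall u, `|u| <= 2 * K + 2 -> m <= logistic_var u) ->
  2 * G / ((n%:R - 2) * m ^+ 2) < 1 ->
  ~~ bad G H h ->
  exists x : 'I_n -> R, [/\ forall i, score (deg h) x i = 0,
    forall y, (forall i, score (deg h) y i = 0) -> x = y &
    forall i, `|x i - b i - deg_dev h i / fisher_diag b i| <=
      2 * (4 * n%:R * (2 * G / ((n%:R - 2) * m ^+ 2)) ^+ 2 + H) /
        ((n%:R - 2) * m ^+ 2)].
Proof.
move=> n2 m01 G0 H0 bK mv G1 /existsPn good.
have gG i : `|deg_dev h i| <= G by have := good i; rewrite negb_or -!leNgt => /andP[].
have gH i : `|weighted_dev h i| <= H.
  by have := good i; rewrite negb_or -!leNgt => /andP[].
have bij i j : `|b i + b j| <= 2 * K.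
  by rewrite (le_trans (ler_normD _ _))// mulr_natl mulr2n lerD.
have [||x [xb sx]] := @mle_exists R n (deg h) b m G K 1 n2 m01 G0 ltr01 bK _ _ G1.
- by move=> u; rewrite mulr1; exact: mv.
- by move=> i; rewrite score_deg normrN.
exists x; split => //.
  by move=> y sy; exact: mle_unique n2 sx sy.
move=> i; have := @mle_expansion R n (deg h) b x m _ H n2 m01 H0 _ sx xb _ i.
rewrite score_deg mulNr; apply.
- by move=> j k; apply: mv; have := bij j k; lra.
- move=> j; rewrite -normrN -sumrN; under eq_bigr do rewrite score_deg mulrN opprK.
  exact: gH.
Qed.

End concentration.

(** * Central limit theorem for the first degrees *)

Section products_of_probabilities.
Context {R : realType}.

Lemma prod_ge_sub (J : finType) (F : J -> R) (e : R) :
  (forall j, 1 - e <= F j) -> (forall j, 0 <= F j <= 1) ->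
  1 - #|J|%:R * e <= \prod_j F j.
Proof.
move=> Fe F01.
(* The cardinal is written as a sum so that it grows along with the product in the induction. *)
suff [] : 1 - (\sum_(j : J) 1)%:R * e <= \prod_j F j /\ 0 <= \prod_j F j <= 1.
  by rewrite sum1_card.
elim/big_rec2 : _ => [|j y m _ [h /andP[y0 y1]]].
  by split; rewrite ?mul0r ?subr0// ler01 lexx.
have /andP[F0 F1] := F01 j; have := Fe j; rewrite natrD.
by split; [nra|apply/andP; split; nra].
Qed.

Lemma prod_lip (J : finType) (F G : J -> R) :
  (forall j, 0 <= F j <= 1) -> (forall j, 0 <= G j <= 1) ->
  `|\prod_j F j - \prod_j G j| <= \sum_j `|F j - G j|.
Proof.
move=> F01 G01.
elim: (index_enum J) => [|j l IH]; first by rewrite !big_nil subrr normr0.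
have /andP[F0 F1] := F01 j.
have /andP[P0 P1] : 0 <= \prod_(i <- l) G i <= 1.
  rewrite prodr_ge0 ?prodr_ile1//= => i _; first by case/andP: (G01 i).
rewrite !big_cons; move: IH P0 P1; set PF := \prod_(i <- l) F i.
set PG := \prod_(i <- l) G i => IH P0 P1.
have -> : F j * PF - G j * PG = (F j - G j) * PG + F j * (PF - PG) by ring.
apply: le_trans (ler_normD _ _) _; rewrite !normrM (ger0_norm P0) (ger0_norm F0).
by apply: lerD; [rewrite ler_piMr|apply: le_trans IH; rewrite ler_piMl].
Qed.

Lemma normal_cdf_lip (x y : R) : `|normal_cdf y - normal_cdf x| <= 9 * `|y - x|.
Proof.
apply: (Lipschitz_derive _ _ is_derive_normal_cdf) => z.
rewrite ger0_norm ?normal_density_ge0//; apply: le_trans (normal_density_moment z).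
rewrite ler_peMl ?normal_density_ge0// lerDl.
by rewrite (_ : z ^+ 4 = (z ^+ 2) ^+ 2) ?sqr_ge0//; ring.
Qed.

Lemma prod_normal_cdf_lip (J : finType) (x y : J -> R) :
  `|\prod_j normal_cdf (y j) - \prod_j normal_cdf (x j)| <= 9 * \sum_j `|y j - x j|.
Proof.
apply: le_trans (prod_lip _ _) _.
- by move=> j; rewrite normal_cdf_ge0 normal_cdf_le1.
- by move=> j; rewrite normal_cdf_ge0 normal_cdf_le1.
by rewrite mulr_sumr; apply: ler_sum => j _; exact: normal_cdf_lip.
Qed.

Lemma inv_sqrt1D (eta : R) : 0 <= eta -> 1 - eta <= inv_sqrt (1 + eta) <= 1.
Proof.
move=> eta0; have s1 : 1 <= Num.sqrt (1 + eta).
  by rewrite -[leLHS]sqrtr1 ler_wsqrtr// lerDl.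
have s2 : Num.sqrt (1 + eta) ^+ 2 = 1 + eta by rewrite sqr_sqrtr// addr_ge0.
rewrite /inv_sqrt; move: s1 s2; set t := Num.sqrt _ => t1 t2.
have t0 : 0 < t by lra.
rewrite invf_le1// t1 andbT -[leRHS]mul1r ler_pdivlMr//.
have : t <= 1 + eta by rewrite -t2; nra.
by nra.
Qed.

(** The cost of a total variance [1 + eta] instead of 1 and of a shift by [u]. *)
Lemma normal_smoothing (x u eta : R) : 0 <= eta ->
  `|(x + u) * inv_sqrt (1 + eta) - x| <= `|x| * eta + `|u|.
Proof.
move=> eta0; have /andP[k1 k2] := inv_sqrt1D eta0.
have k0 : 0 <= inv_sqrt (1 + eta) by rewrite ltW// inv_sqrt_gt0//; lra.
move: k1 k2 k0; set k := inv_sqrt _ => k1 k2 k0.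
have -> : (x + u) * k - x = - (x * (1 - k)) + u * k by ring.
apply: le_trans (ler_normD _ _) _; rewrite normrN !normrM.
rewrite (ger0_norm k0) [`|1 - k|]ger0_norm ?subr_ge0//.
by rewrite lerD ?ler_piMr// ler_wpM2l//; lra.
Qed.

End products_of_probabilities.

(** * Gaussian approximation for edges leaving the first r vertices *)

Section clt.
Context {R : realType} {r s : nat} (b : 'I_(r + s) -> R).
Hypothesis r1 : (1 <= r)%N.
Let n := (r + s)%N.
Implicit Types (i k : 'I_n) (j : 'I_r) (e : 'I_n * 'I_n) (h : 'I_n * 'I_n -> bool).

Let D j : R := fisher_diag b (lshift s j).
Let p : 'I_n * 'I_n -> R := edge_p b.

(* The edges joining vertex j < r to the vertices k >= r: no edge serves two
   different values of j. *)
Definition outer_weight j e : R :=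
  if (e.1 == lshift s j) && (r <= e.2)%N then inv_sqrt (D j) else 0.

Definition outer_dev h j : R := centered_sum p (outer_weight j) edges h.

Lemma sum_outer j (F : 'I_n * 'I_n -> R) :
  \sum_(e <- edges) (if (e.1 == lshift s j) && (r <= e.2)%N then F e else 0) =
  \sum_(k < n | (r <= k)%N) F (lshift s j, k).
Proof.
rewrite big_edges (bigD1 (lshift s j))//= eqxx/= [X in _ + X]big1 ?addr0; last first.
  by move=> i /negbTE ij; apply: big1 => k _; rewrite ij.
rewrite -big_mkcondr/=; apply: eq_bigl => k.
by apply/andb_idl; apply: leq_trans.
Qed.

Lemma sum_inner_le j (F : 'I_n -> R) : (forall k, F k <= 1) ->
  \sum_(k < n | (k != lshift s j) && ~~ (r <= k)%N) F k <= r%:R.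
Proof.
move=> F1; apply: (@le_trans _ _ (\sum_(k < n) (k < r)%N%:R)); last first.
  rewrite big_split_ord/= [X in _ + X]big1 ?addr0; last first.
    by move=> k _; rewrite ltnNge leq_addr.
  rewrite (eq_bigr (fun=> 1)); last by move=> k _; rewrite ltn_ord.
  by rewrite sumr_const card_ord.
rewrite big_mkcond/=; apply: ler_sum => k _; rewrite -ltnNge.
by case: (k != _) => //=; case: ifP.
Qed.

Hypothesis D1 : forall j, 1 <= D j.

Let D0 j : 0 < D j. Proof. exact: lt_le_trans (D1 j). Qed.

Let inv_sqrtD2 j : inv_sqrt (D j) ^+ 2 = (D j)^-1.
Proof. by rewrite /inv_sqrt exprVn sqr_sqrtr// ltW. Qed.

Lemma outer_devE h j : outer_dev h j =
  inv_sqrt (D j) * \sum_(k < n | (r <= k)%N) ((h (lshift s j, k))%:R - p (lshift s j, k)).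
Proof.
rewrite mulr_sumr -(sum_outer j (fun e => inv_sqrt (D j) * ((h e)%:R - p e))).
apply: eq_bigr => e _; rewrite /outer_weight.
by case: ifP => // _; rewrite mul0r.
Qed.

(** The dropped edges number at most [r], and each contributes a deviation of at most 1. *)
Lemma deg_dev_outer h j :
  `|inv_sqrt (D j) * deg_dev b h (lshift s j) - outer_dev h j| <= r%:R * inv_sqrt (D j).
Proof.
have k0 : 0 < inv_sqrt (D j) by rewrite inv_sqrt_gt0.
rewrite outer_devE -mulrBr normrM gtr0_norm// mulrC ler_pM2r//.
rewrite /deg_dev (bigID (fun k : 'I_n => (r <= k)%N))/=.
rewrite [X in `|X + _ - _|](_ : _ = \sum_(k < n | (r <= k)%N)
    ((h (lshift s j, k))%:R - p (lshift s j, k))); last first.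
  have jk k : (r <= k)%N -> (lshift s j < k)%N by exact: leq_trans (ltn_ord j).
  apply: eq_big => k.
    apply/andb_idl => /jk; rewrite neq_ltn => ->; rewrite orbT//.
  by move=> /andP[_ /jk jk']; rewrite /edge_of jk'.
rewrite addrAC subrr add0r (le_trans (ler_norm_sum _ _ _))//.
apply: sum_inner_le => k.
have /andP[p0 p1] := edge_p01 b (edge_of (lshift s j) k).
have c01 (c : bool) : 0 <= (c%:R : R) <= 1 by case: c; rewrite ler01 lexx.
have /andP[c0 c1] := c01 (h (edge_of (lshift s j) k)).
by rewrite ler_norml; apply/andP; split; lra.
Qed.

Lemma outer_variance j :
  \sum_(e <- edges) p e * (1 - p e) * outer_weight j e ^+ 2 =
  1 - \sum_(k < n | (k != lshift s j) && ~~ (r <= k)%N)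
        logistic_var (b (lshift s j) + b k) / D j.
Proof.
transitivity (\sum_(k < n | (r <= k)%N) logistic_var (b (lshift s j) + b k) / D j).
  rewrite -(sum_outer j (fun e => logistic_var (b e.1 + b e.2) / D j)).
  apply: eq_bigr => e _; rewrite /outer_weight; case: ifP => _.
    by rewrite inv_sqrtD2 logistic_varE.
  by rewrite expr0n mulr0.
have -> : 1 = \sum_(k < n | k != lshift s j) logistic_var (b (lshift s j) + b k) / D j.
  by rewrite -mulr_suml -/(fisher_diag b (lshift s j)) -/(D j) divff// gt_eqF.
rewrite [X in _ = X - _](bigID (fun k : 'I_n => (r <= k)%N))/= addrK.
apply: eq_bigl => k; rewrite andb_idl// => rk.
by rewrite neq_ltn (leq_trans (ltn_ord j) rk : (lshift s j < k)%N) orbT.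
Qed.

Lemma outer_variance_bounds j :
  1 - r%:R / D j <= \sum_(e <- edges) p e * (1 - p e) * outer_weight j e ^+ 2 <= 1.
Proof.
rewrite outer_variance lerD2l lerN2 gerBl -mulr_suml; apply/andP; split.
  rewrite ler_pM2r ?invr_gt0//; apply: sum_inner_le => k; exact: logistic_var_le1.
rewrite mulr_ge0 ?invr_ge0 ?(ltW (D0 j))// sumr_ge0// => k _.
exact/ltW/logistic_var_gt0.
Qed.

Lemma outer_third_moment :
  \sum_(e <- edges) \sum_j `|outer_weight j e| ^+ 3 <=
  n%:R * \sum_j inv_sqrt (D j) ^+ 3.
Proof.
rewrite exchange_big/= mulr_sumr; apply: ler_sum => j _.
have k0 : 0 < inv_sqrt (D j) by rewrite inv_sqrt_gt0.
rewrite (eq_bigr (fun e => if (e.1 == lshift s j) && (r <= e.2)%N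
    then inv_sqrt (D j) ^+ 3 else 0)); last first.
  move=> e _; rewrite /outer_weight; case: ifP => _; first by rewrite gtr0_norm.
  by rewrite normr0 expr0n.
rewrite (sum_outer j (fun=> inv_sqrt (D j) ^+ 3)) big_mkcond/=.
apply: (@le_trans _ _ (\sum_(k < n) inv_sqrt (D j) ^+ 3)).
  by apply: ler_sum => k _; case: ifP => // _; rewrite exprn_ge0// ltW.
by rewrite sumr_const card_ord mulr_natl.
Qed.

Definition smoothing_constant (eta : R) : R :=
  18 * inv_sqrt eta ^+ 3 + 9 * inv_sqrt eta ^+ 4.

(** Lindeberg replacement runs from time [1 + eta] down to a time in [[eta, 2 eta]], where
    [normal_cdf] is a smoothed indicator. Shifting [x] by [delta] either way sandwiches the true
    indicator up to multiples of [e1]. *)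
Lemma clt (eta delta e1 : R) (x : 'I_r -> R) g :
  0 < eta -> 0 < delta -> 0 <= e1 -> (forall j, r%:R / D j <= eta) ->
  1 - e1 <= normal_cdf (delta * inv_sqrt (2 * eta)) ->
  normal_cdf (- delta * inv_sqrt (2 * eta)) <= e1 ->
  `|Ex p edges (fun h => [forall j, outer_dev h j <= x j]%:R) g -
    \prod_j normal_cdf (x j)| <=
  9 * \sum_j (`|x j| * eta + delta) + r.+1%:R * e1 +
  smoothing_constant eta * (n%:R * \sum_j inv_sqrt (D j) ^+ 3).
Proof.
move=> eta0 delta0 e10 rD Phi1 Phi0.
pose V j := \sum_(e <- edges) p e * (1 - p e) * outer_weight j e ^+ 2.
have V1 j : eta <= 1 + eta - V j.
  by have /andP[_] := outer_variance_bounds j; rewrite -/(V j); lra.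
have V2 j : 1 + eta - V j <= 2 * eta.
  have /andP[+ _] := outer_variance_bounds j; rewrite -/(V j).
  by have := rD j; lra.
pose kV j := inv_sqrt (1 + eta - V j).
have kV0 j : 0 < kV j by rewrite inv_sqrt_gt0// (lt_le_trans eta0).
have kV1 j : inv_sqrt (2 * eta) <= kV j.
  by rewrite inv_sqrt_le// (lt_le_trans eta0).
pose A (u : R) h : R := \prod_j normal_cdf ((x j + u - outer_dev h j) * kV j).
have C0 : 0 <= smoothing_constant eta.
  by rewrite addr_ge0// mulr_ge0// exprn_ge0// ltW// inv_sqrt_gt0.
have LA (u : R) : `|u| <= delta ->
    `|Ex p edges (A u) g - \prod_j normal_cdf (x j)| <=
    9 * \sum_j (`|x j| * eta + delta) +
    smoothing_constant eta * (n%:R * \sum_j inv_sqrt (D j) ^+ 3).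
  move=> ud.
  have L := @lindeberg R _ _ p outer_weight eta edges (fun j => x j + u)
    (fun=> 1 + eta) g (edge_p01 b) eta0 edges_uniq.
  rewrite -(subrKA (\prod_j normal_cdf ((x j + u) * inv_sqrt (1 + eta)))).
  apply: le_trans (ler_normD _ _) _; rewrite addrC; apply: lerD.
    apply: le_trans (prod_normal_cdf_lip _ _) _; rewrite ler_pM2l//.
    apply: ler_sum => j _; apply: le_trans (normal_smoothing _ _ (ltW eta0)) _.
    by rewrite lerD2l.
  apply: (le_trans (L _ _ _)).
  - move=> e _; have [j ej|ne] := pickP (fun j => e.1 == lshift s j).
      exists j => j' jj'; rewrite /outer_weight (eqP ej).
      by rewrite (inj_eq (@lshift_inj _ _)) eq_sym (negbTE jj').
    (* Such an edge affects no coordinate, so any index serves, and [r >= 1] supplies one. *)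
    by exists (Ordinal r1) => j _; rewrite /outer_weight ne.
  - move=> j e _; rewrite /outer_weight; case: ifP => _; last by rewrite normr0.
    rewrite gtr0_norm ?inv_sqrt_gt0// /inv_sqrt invf_le1 ?sqrtr_gt0//.
    by rewrite -[leLHS]sqrtr1 ler_wsqrtr.
  - by move=> j; exact: V1.
  - by rewrite ler_wpM2l// outer_third_moment.
have A01 u h : 0 <= A u h <= 1.
  rewrite prodr_ge0 ?prodr_ile1//= => j _;
  by rewrite ?normal_cdf_ge0 ?normal_cdf_le1.
have r0 : 0 <= r%:R * e1 by rewrite mulr_ge0.
(* When the indicator is 1, every factor of [A delta h] is at least [1 - e1]. *)
have up : Ex p edges (fun h => [forall j, outer_dev h j <= x j]%:R) g <=
    Ex p edges (A delta) g + r%:R * e1.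
  rewrite -[X in _ + X](Ex_cst p edges _ g) -ExD.
  apply: Ex_le; first exact: edge_p01.
  move=> h; have /andP[A0 _] := A01 delta h.
  have [/forallP hx|_] := boolP [forall j, outer_dev h j <= x j]; last first.
    by rewrite addr_ge0.
  have pg := @prod_ge_sub R 'I_r _ e1; rewrite card_ord in pg.
  rewrite -lerBlDr; apply: pg => j; last first.
    by rewrite normal_cdf_ge0 normal_cdf_le1.
  apply: le_trans Phi1 _; apply: normal_cdf_le; apply: ler_pM => //.
  - exact: ltW.
  - by rewrite ltW// inv_sqrt_gt0// mulr_gt0.
  - by rewrite addrAC lerDr subr_ge0.
(* When the indicator is 0, some coordinate exceeds [x j], and its factor alone brings
   [A (- delta) h] below [e1]. *)
have lo : Ex p edges (A (- delta)) g - e1 <=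
    Ex p edges (fun h => [forall j, outer_dev h j <= x j]%:R) g.
  rewrite -[X in _ - X](Ex_cst p edges _ g) lerBlDr -ExD.
  apply: Ex_le; first exact: edge_p01.
  move=> h; have /andP[A0 A1] := A01 (- delta) h.
  have [_|] := boolP [forall j, outer_dev h j <= x j]; first by rewrite ler_wpDr.
  rewrite negb_forall => /existsP[j]; rewrite -ltNge => hj.
  rewrite add0r /A (bigD1 j)//=; apply: (@le_trans _ _ (normal_cdf _ * 1)).
    apply: ler_wpM2l; first exact: normal_cdf_ge0.
    by apply: prodr_ile1 => i _; rewrite normal_cdf_ge0 normal_cdf_le1.
  rewrite mulr1; apply: le_trans Phi0; apply: normal_cdf_le.
  rewrite mulNr lerNr -mulNr; apply: ler_pM => //.
  - exact: ltW.
  - by rewrite ltW// inv_sqrt_gt0// mulr_gt0.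
  - lra.
have := LA delta; have := LA (- delta); rewrite normrN gtr0_norm// lexx.
move=> /(_ isT) h1 /(_ isT) h2.
move: h1 h2; rewrite -natr1 mulrDl mul1r !ler_norml => /andP[h1 _] /andP[_ h2].
by apply/andP; split; lra.
Qed.

End clt.

(** * Asymptotics *)

Section log_growth.
Context {R : realType}.

Lemma ln_nat_ge (A : R) : exists N, forall n, (N <= n)%N -> A <= ln n%:R.
Proof.
exists (Num.bound (expR A)) => n Nn.
have h : expR A < n%:R.
  apply: lt_le_trans (_ : (Num.bound (expR A))%:R <= _); last by rewrite ler_nat.
  exact: archi_boundP (expR_ge0 A).
rewrite -ler_expR lnK ?ltW// posrE.
exact: lt_trans (expR_gt0 _) h.
Qed.

(** With [y = ln n / (2 (k + 1))], [sqrt n] is the power [k + 1] of [expR y], hence at least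
    [y ^+ k.+1]: one more power of [ln n] than the numerator. *)
Lemma ln_exp_sqrt_small k (c : R) : 0 < c ->
  exists N, forall n, (N <= n)%N -> ln n%:R ^+ k / Num.sqrt n%:R <= c.
Proof.
move=> c0.
pose C : R := (2 * k.+1%:R) ^+ k.+1.
have [N hN] := ln_nat_ge (C / c + 1).
have C0 : 0 < C by rewrite exprn_gt0// mulr_gt0.
exists N => n /hN; set q := ln _ => hq.
have q0 : 0 < q by apply: lt_le_trans hq; rewrite ltr_wpDl// divr_ge0 ?ltW.
(* The value [ln 0 = 0] lets [q > 0] exclude [n = 0]. *)
have n0 : 0 < n%:R :> R.
  by rewrite lt_neqAle ler0n andbT; apply: contraTneq q0 => nn; rewrite /q -nn ln0 ?ltxx.
set y : R := q / (2 * k.+1%:R).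
have k0 : 0 < 2 * k.+1%:R :> R by rewrite mulr_gt0.
have y0 : 0 <= y by rewrite divr_ge0// ltW.
have sq : Num.sqrt n%:R = expR y ^+ k.+1 :> R.
  have -> : n%:R = (expR y ^+ k.+1) ^+ 2 :> R.
    rewrite -exprM mulnC -expRM_natr natrM [_ * k.+1%:R]mulrC /y.
    rewrite (_ : q / _ * _ = q) ?lnK//; by field; rewrite nat1r pnatr_eq0.
  by rewrite sqrtr_sqr ger0_norm// exprn_ge0// expR_ge0.
have ey : y <= expR y by apply: le_trans (expR_ge1Dx y); rewrite lerDr.
have yk : y ^+ k.+1 <= Num.sqrt n%:R by rewrite sq lerXn2r// nnegrE ?expR_ge0.
have s0 : 0 < Num.sqrt n%:R :> R by rewrite sqrtr_gt0.
rewrite ler_pdivrMr//; apply: le_trans (ler_wpM2l (ltW c0) yk).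
rewrite /y expr_div_n -/C exprS mulrA mulrA mulrAC ler_peMl ?exprn_ge0 ?(ltW q0)//.
rewrite ler_pdivlMr// mul1r -ler_pdivrMl// mulrC; lra.
Qed.

End log_growth.

(** * The random graph and its estimator *)

Section model.
Context {R : realType} {r s : nat}.
Let n := (r + s)%N.
Context (b : 'cV[R]_n) d (T : measurableType d) (P : probability T R)
  (adj : T -> rel 'I_n).
Hypothesis hmodel : beta_model P b adj.

Let bb (i : 'I_n) : R := b i 0.

Definition graph_config (w : T) : 'I_n * 'I_n -> bool :=
  config (fun e => [set w | adj w e.1 e.2]) edges (fun=> false) w.

Lemma probability_graph_config (B : ('I_n * 'I_n -> bool) -> bool) :
  P [set w | B (graph_config w)] =
  (Ex (edge_p bb) edges (fun h => (B h)%:R) (fun=> false))%:E.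
Proof.
case: hmodel => _ _ mA PA ind.
apply: (@probability_config R d T P _ [pred ij : 'I_n * 'I_n | (ij.1 < ij.2)%N]
  (fun e => [set w | adj w e.1 e.2]) (edge_p bb) _ _ ind).
- by move=> e; exact: mA.
- move=> e /= e12; rewrite PA//.
  by apply: contraTneq e12 => ->; rewrite ltnn.
- exact: edges_uniq.
- by move=> e; rewrite mem_edges inE.
Qed.

Lemma measurable_graph_config (B : ('I_n * 'I_n -> bool) -> bool) :
  measurable [set w | B (graph_config w)].
Proof.
case: hmodel => _ _ mA PA ind.
apply: measurable_config; [by move=> e; exact: mA|exact: edges_uniq].
Qed.

Lemma graph_config_edge_of w i j : j != i -> graph_config w (edge_of i j) = adj w i j.
Proof.
case: hmodel => sym _ _ _ _ ji.
rewrite /graph_config /config mem_edges /edge_of.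
have [ij|ij|ij] := ltngtP (i : nat) j.
- by rewrite /= ij asboolb.
- by rewrite /= ij asboolb sym.
- by rewrite (val_inj ij) eqxx in ji.
Qed.

Lemma deg_graph_config w i : deg (graph_config w) i = (degree (adj w) i)%:R :> R.
Proof.
case: hmodel => _ irr _ _ _.
rewrite /deg /degree -sum1_card natr_sum [RHS]big_mkcond/= [RHS](bigD1 i)//= inE irr add0r.
by apply: eq_bigr => j ji; rewrite graph_config_edge_of// inE; case: (adj w i j).
Qed.

Lemma likelihood_equationsP w x : likelihood_equations (adj w) x <->
  forall i, score (deg (graph_config w)) (fun j => x j 0 : R) i = 0.
Proof.
split=> h i; have := h i; rewrite /score deg_graph_config.
  by rewrite (_ : \sum_(j | j != i) edge_prob x i j =
    \sum_(j | j != i) logistic (x i 0 + x j 0))// => ->; rewrite subrr.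
by move=> /eqP; rewrite subr_eq0 => /eqP <-.
Qed.

Context (bhat : T -> 'cV[R]_n).
Hypothesis hmle : is_mle adj bhat.

Let X (w : T) (j : 'I_r) : R := usubmx (sqrt_diag_fisher b *m (bhat w - b)) j 0.

Lemma rescaled_errorE w j : X w j = Num.sqrt (fisher_diag bb (lshift s j)) *
  (bhat w (lshift s j) 0 - bb (lshift s j)).
Proof.
by rewrite /X mxE /sqrt_diag_fisher mul_diag_mx !mxE eqxx.
Qed.

Lemma measurable_rescaled_error (x : 'I_r -> R) :
  measurable [set w | forall j, X w j <= x j].
Proof.
rewrite (_ : [set w | _] = \bigcap_(j in [set: 'I_r]) [set w | X w j <= x j]); last first.
  by apply/seteqP; split => [w h j _|w h j]; [exact: h|exact: (h j)].
apply: fin_bigcap_measurable => // j _.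
have mX : measurable_fun setT (X ^~ j).
  rewrite (_ : X ^~ j = (fun w => Num.sqrt (fisher_diag bb (lshift s j)) *
    (bhat w (lshift s j) 0 - bb (lshift s j)))); last first.
    by apply/funext => w; exact: rescaled_errorE.
  apply: measurable_funM => //; apply: measurable_funB => //.
  exact: hmle.1.
have := mX measurableT _ (measurable_itv `]-oo, x j]).
rewrite setTI; congr measurable; apply/seteqP; split => w /=; rewrite in_itv//=.
Qed.

(** Off the bad event the rescaled error is within [tau] of [outer_dev]: the expansion error times
    [sqrt n], plus the dropped edges. The distribution function at [x] is thus compared with that of
    [outer_dev] at [x + tau] and [x - tau]. *)
Lemma rescaled_error_cvg (m K G H kappa tau eta delta e1 epsb : R) (x : 'I_r -> R) :
  (1 <= r)%N -> (2 < n)%N -> 0 < m <= 1 -> 0 <= G -> 0 <= H ->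
  (forall i, `|bb i| <= K) ->
  (forall u, `|u| <= 2 * K + 2 -> m <= logistic_var u) ->
  2 * G / ((n%:R - 2) * m ^+ 2) < 1 ->
  Ex (edge_p bb) edges (fun h => (bad bb G H h)%:R) (fun=> false) <= epsb ->
  (forall j, 1 <= fisher_diag bb (lshift s j)) ->
  (forall j, inv_sqrt (fisher_diag bb (lshift s j)) <= kappa) ->
  (forall j, r%:R / fisher_diag bb (lshift s j) <= eta) ->
  Num.sqrt n%:R * (2 * (4 * n%:R * (2 * G / ((n%:R - 2) * m ^+ 2)) ^+ 2 + H) /
        ((n%:R - 2) * m ^+ 2)) + r%:R * kappa <= tau ->
  0 < eta -> 0 < delta -> 0 <= e1 ->
  1 - e1 <= normal_cdf (delta * inv_sqrt (2 * eta)) ->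
  normal_cdf (- delta * inv_sqrt (2 * eta)) <= e1 ->
  `|fine (P [set w | forall j, X w j <= x j]) - \prod_j normal_cdf (x j)| <=
  epsb + (9 * \sum_j ((`|x j| + tau) * eta + delta + tau) + r.+1%:R * e1 +
    smoothing_constant eta * (n%:R * (r%:R * kappa ^+ 3))).
Proof.
move=> r1 n2 m01 G0 H0 bK mv G1 Ebad D1 Dk rD htau eta0 delta0 e10 Phi1 Phi0.
have D0 j : 0 < fisher_diag bb (lshift s j) by exact: lt_le_trans (D1 j).
have k0 j : 0 < inv_sqrt (fisher_diag bb (lshift s j)) by rewrite inv_sqrt_gt0.
have near w : ~~ bad bb G H (graph_config w) ->
    forall j, `|X w j - outer_dev bb (graph_config w) j| <= tau.
  move=> good j.
  have [y [sy uy ey]] := good_expansion n2 m01 G0 H0 bK mv G1 good.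
  (* Uniqueness on the good event identifies the estimator with the solution [y]. *)
  have bhy : bhat w = \col_i y i.
    apply: hmle.2; split.
      by apply/likelihood_equationsP => i; under [fun j => _]eq_fun do rewrite mxE.
    move=> z /likelihood_equationsP /uy ->.
    by apply/colP => i; rewrite mxE.
  rewrite rescaled_errorE bhy mxE; apply: le_trans htau.
  set D := fisher_diag bb (lshift s j).
  have Dn0 : Num.sqrt D != 0 by rewrite gt_eqF// sqrtr_gt0; exact: D0.
  rewrite -(subrKA (inv_sqrt D * deg_dev bb (graph_config w) (lshift s j))).
  apply: le_trans (ler_normD _ _) _; apply: lerD.
    have eD : inv_sqrt D * deg_dev bb (graph_config w) (lshift s j) =
        Num.sqrt D * (deg_dev bb (graph_config w) (lshift s j) / D).
      rewrite -[X in _ / X]sqr_sqrtr ?(ltW (D0 j))// /inv_sqrt.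
      by field.
    rewrite eD -mulrBr normrM ger0_norm ?sqrtr_ge0//.
    apply: ler_pM; [exact: sqrtr_ge0|exact: normr_ge0| |exact: ey].
    by rewrite ler_wsqrtr// fisher_diag_le.
  apply: le_trans (deg_dev_outer D1 (graph_config w) j) _.
  by rewrite ler_wpM2l.
have tau0 : 0 <= tau.
  apply: le_trans htau; have j0 := Ordinal r1.
  have N2 : 0 < n%:R - 2 :> R by rewrite subr_gt0 ltr_nat.
  case/andP: (m01) => m0 _.
  have Nm : 0 < (n%:R - 2) * m ^+ 2 by rewrite mulr_gt0// exprn_gt0.
  apply: addr_ge0; apply: mulr_ge0 => //.
    apply: divr_ge0; last exact: ltW.
    apply: mulr_ge0 => //; apply: addr_ge0 => //.
    by apply: mulr_ge0; [exact: mulr_ge0|exact: sqr_ge0].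
  exact: le_trans (ltW (k0 j0)) (Dk j0).
have third : smoothing_constant eta *
    (n%:R * \sum_j inv_sqrt (fisher_diag bb (lshift s j)) ^+ 3) <=
    smoothing_constant eta * (n%:R * (r%:R * kappa ^+ 3)).
  apply: ler_wpM2l.
    by apply: addr_ge0; apply: mulr_ge0 => //; apply: exprn_ge0;
      rewrite ltW// inv_sqrt_gt0.
  apply: ler_wpM2l => //.
  apply: (@le_trans _ _ (\sum_(j < r) kappa ^+ 3)).
    apply: ler_sum => j _; apply: lerXn2r (Dk j); rewrite nnegrE ?(ltW (k0 j))//.
    exact: le_trans (ltW (k0 j)) (Dk j).
  by rewrite sumr_const card_ord mulr_natl.
have C u : `|u| = tau ->
    `|Ex (edge_p bb) edges (fun h => [forall j, outer_dev bb h j <= x j + u]%:R) (fun=> false) -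
      \prod_j normal_cdf (x j)| <=
    9 * \sum_j ((`|x j| + tau) * eta + delta + tau) + r.+1%:R * e1 +
    smoothing_constant eta * (n%:R * (r%:R * kappa ^+ 3)).
  move=> utau.
  have c := @clt R r s bb r1 D1 eta delta e1 (fun j => x j + u) (fun=> false)
    eta0 delta0 e10 rD Phi1 Phi0.
  rewrite -(subrKA (\prod_j normal_cdf (x j + u))).
  apply: le_trans (ler_normD _ _) _.
  apply: le_trans (lerD c (prod_normal_cdf_lip _ _)) _.
  rewrite (_ : \sum_j `|x j + u - x j| = \sum_(j < r) tau); last first.
    by apply: eq_bigr => j _; rewrite [x j + u - x j]addrAC subrr add0r.
  rewrite [X in _ <= 9 * X + _ + _]big_split/=.
  have : \sum_j (`|x j + u| * eta + delta) <= \sum_j ((`|x j| + tau) * eta + delta).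
    apply: ler_sum => j _; rewrite lerD2r ler_pM2r// -utau; exact: ler_normD.
  move: third; set A1 := smoothing_constant _ * _; set A2 := smoothing_constant _ * _.
  set A3 := \sum_j (`|x j + u| * eta + delta).
  set A4 := \sum_j ((`|x j| + tau) * eta + delta).
  by set A5 := \sum_(j < r) tau; lra.
have Cp := C tau (ger0_norm tau0).
have Cm : `|- tau| = tau by rewrite normrN ger0_norm.
have {}Cm := C _ Cm.
set PS := P [set w | forall j, X w j <= x j].
have PSf : PS \is a fin_num by rewrite fin_num_measure//; exact: measurable_rescaled_error.
(* [B1] and [B2] enclose the event of interest and depend on the edges only, so [Ex] gives their
   probabilities; the estimator itself may be arbitrary on the bad event. *)
pose B1 h := bad bb G H h || [forall j, outer_dev bb h j <= x j + tau].
pose B2 h := ~~ bad bb G H h && [forall j, outer_dev bb h j <= x j - tau].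
have up : fine PS <= Ex (edge_p bb) edges (fun h => (B1 h)%:R) (fun=> false).
  rewrite -lee_fin fineK// -probability_graph_config le_measure ?inE//.
  - exact: measurable_rescaled_error.
  - exact: measurable_graph_config.
  move=> w /= hw; rewrite /B1; have [//|/near hn] := boolP (bad _ _ _ _).
  apply/forallP => j; have := hn j; rewrite ler_norml => /andP[h1 _].
  by have := hw j; lra.
have lo : Ex (edge_p bb) edges (fun h => (B2 h)%:R) (fun=> false) <= fine PS.
  rewrite -lee_fin fineK// -probability_graph_config le_measure ?inE//.
  - exact: measurable_graph_config.
  - exact: measurable_rescaled_error.
  move=> w /= /andP[/near hn /forallP hw] j.
  by have := hn j; rewrite ler_norml => /andP[_ h1]; have := hw j; lra.
have up2 : Ex (edge_p bb) edges (fun h => (B1 h)%:R) (fun=> false) <= epsb +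
    Ex (edge_p bb) edges (fun h => [forall j, outer_dev bb h j <= x j + tau]%:R) (fun=> false).
  apply: le_trans (lerD Ebad (lexx _)); rewrite -ExD.
  apply: Ex_le; first exact: edge_p01.
  move=> h; rewrite /B1.
  by case: (bad _ _ _ _); case: [forall j, _]; rewrite ?addr0 ?add0r ?lerDl ?ler01.
have lo2 : Ex (edge_p bb) edges (fun h => [forall j, outer_dev bb h j <= x j - tau]%:R)
    (fun=> false) - epsb <= Ex (edge_p bb) edges (fun h => (B2 h)%:R) (fun=> false).
  rewrite lerBlDl; apply: le_trans (lerD Ebad (lexx _)); rewrite -ExD.
  apply: Ex_le; first exact: edge_p01.
  move=> h; rewrite /B2.
  by case: (bad _ _ _ _); case: [forall j, _]; rewrite ?addr0 ?add0r ?ler01.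
move: Cp Cm; rewrite !ler_norml => /andP[_ h1] /andP[h2 _].
by apply/andP; split; lra.
Qed.

End model.

(** * Error bounds in powers of the logarithm *)

Section rate.
Context {R : realType}.

(** The general lower bound is here at least [1 / (4 e^2 q^2)], and [4 e^2 <= q] absorbs the
    constant into a third power. *)
Lemma logistic_var_ge_log (K q u : R) : 4 * expR 2 <= q -> K <= ln q ->
  `|u| <= 2 * K + 2 -> (q ^+ 3)^-1 <= logistic_var u.
Proof.
move=> hq Kq hu.
have e2 : 0 < expR 2 :> R by exact: expR_gt0.
have q0 : 0 < q by apply: lt_le_trans hq; rewrite mulr_gt0.
apply: le_trans (logistic_var_ge u).
apply: (@le_trans _ _ (expR (- (2 * ln q + 2)) / 4)); last first.
  by rewrite ler_pM2r// ler_expR lerN2 (le_trans hu)// lerD2r ler_pM2l.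
rewrite expRN expRD [2 * ln q]mulrC expRM_natr lnK ?posrE// -invfM.
rewrite lef_pV2 ?posrE ?mulr_gt0 ?exprn_gt0// -mulrA (exprSr q 2).
by rewrite ler_pM2l ?exprn_gt0// mulrC.
Qed.

(** The exponent 20 is the largest one needed: it arises as 14 + 6 in [rate_tau]. *)
Lemma expr_le20 (q : R) k : 1 <= q -> (k <= 20)%N -> q ^+ k <= q ^+ 20.
Proof. by move=> q1 k20; rewrite ler_weXn2l. Qed.

(* q = ln t, S = sqrt t, N = t, and m = q^-3 bounds the edge variances below. *)
Variables (q S N : R).
Hypotheses (q1 : 1 <= q) (hS : forall k, (k <= 20)%N -> 20 * q ^+ k <= S).
Hypothesis NS : N = S ^+ 2.

Let S20 : 20 <= S. Proof. by have := @hS 0%N isT; rewrite expr0 mulr1. Qed.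
Let S0 : 0 < S. Proof. exact: lt_le_trans S20. Qed.
Let q0 : 0 < q. Proof. exact: lt_le_trans q1. Qed.
Let m : R := (q ^+ 3)^-1.
Let m0 : 0 < m. Proof. by rewrite invr_gt0 exprn_gt0. Qed.

Lemma rate_N_ge : 20 * S <= N.
Proof. by rewrite NS expr2 ler_pM2r. Qed.

(** As [N - 2 >= N / 2] and [m ^+ 2] is the inverse of [q ^+ 6], division by [(N - 2) * m ^+ 2]
    costs a factor 2 and six powers of [q]. *)
Lemma rate_denominator (c : R) k j : 0 <= c -> (k + 6 = j)%N ->
  c * q ^+ k * S <= 2 * c * (q ^+ j / S) * ((N - 2) * m ^+ 2).
Proof.
move=> c0 <-; have hS20 : 20 <= S := S20.
have N4 := rate_N_ge; have h : N / 2 <= N - 2 by lra.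
have w0 : 0 <= 2 * c * (q ^+ (k + 6) / S).
  apply: mulr_ge0; first exact: mulr_ge0.
  by apply: divr_ge0; [apply: exprn_ge0|]; exact: ltW.
apply: le_trans (ler_wpM2l w0 (ler_wpM2r (exprn_ge0 2 (ltW m0)) h)).
rewrite NS /m exprD; set x := q ^+ k.
rewrite le_eqVlt; apply/orP; left; apply/eqP.
by field; rewrite !gt_eqF.
Qed.

Let N2m0 : 0 < (N - 2) * m ^+ 2.
Proof.
have hS20 : 20 <= S := S20; have N4 := rate_N_ge.
by apply: mulr_gt0; [lra|exact: exprn_gt0].
Qed.

Lemma rate_G : 2 * (4 * Num.sqrt (N * q)) / ((N - 2) * m ^+ 2) <= 16 * (q ^+ 7 / S).
Proof.
have sq : Num.sqrt (N * q) <= S * q.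
  have -> : S * q = Num.sqrt ((S * q) ^+ 2).
    by rewrite sqrtr_sqr ger0_norm// mulr_ge0// ltW.
  apply: ler_wsqrtr; rewrite NS exprMn; apply: ler_wpM2l; first exact: sqr_ge0.
  by rewrite expr2 ler_peMl// ltW.
rewrite ler_pdivrMr; last exact: N2m0.
have h := @rate_denominator 8 1 7 (ler0n _ 8) erefl; rewrite expr1 in h.
rewrite (_ : 2 * 8 = 16 :> R) in h; last by ring.
by apply: le_trans h; move: sq; set x := Num.sqrt _; lra.
Qed.

Lemma rate_tau (rho : R) : 0 <= rho -> rho <= 16 * (q ^+ 7 / S) ->
  S * (2 * (4 * N * rho ^+ 2 + (2 * q + 32 / m ^+ 2)) / ((N - 2) * m ^+ 2)) <=
  2 * 2116 * (q ^+ 20 / S).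
Proof.
move=> rho0 rhoq; have hS20 : 20 <= S := S20; have N4 := rate_N_ge.
have h1 : 4 * N * rho ^+ 2 <= 1024 * q ^+ 14.
  apply: (@le_trans _ _ (4 * N * (16 * (q ^+ 7 / S)) ^+ 2)).
    apply: ler_wpM2l; first by lra.
    by apply: lerXn2r => //; rewrite nnegrE// (le_trans rho0).
  by rewrite NS le_eqVlt; apply/orP; left; apply/eqP; field; rewrite gt_eqF.
have h2 : 2 * q + 32 / m ^+ 2 <= 34 * q ^+ 14.
  have -> : 32 / m ^+ 2 = 32 * q ^+ 6.
    by rewrite /m; field; rewrite gt_eqF.
  have a1 : q <= q ^+ 14 by rewrite -{1}[q]expr1 ler_weXn2l.
  have a2 : q ^+ 6 <= q ^+ 14 by rewrite ler_weXn2l.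
  by move: a1 a2; set x := q ^+ 14; set y := q ^+ 6; lra.
rewrite mulrA ler_pdivrMr; last exact: N2m0.
(* 2116 is 2 (1024 + 34), from [h1] and [h2]. *)
have h := @rate_denominator 2116 14 20 (ler0n _ 2116) erefl.
apply: le_trans h.
rewrite mulrC; apply: ler_wpM2r; first exact: ltW.
by move: h1 h2; set x := q ^+ 14; set y := 4 * N * _; set z := 2 * q + _; lra.
Qed.

Lemma rate_kappa (D : R) : (N - 1) * m <= D -> [/\ 1 <= D,
  inv_sqrt D <= 2 * (q ^+ 2 / S) & forall r : nat, r%:R / D <= 4 * r%:R * (q ^+ 20 / S)].
Proof.
move=> hD; have hS20 : 20 <= S := S20; have N4 := rate_N_ge.
(* [D] is at least [N / (2 q^3)]; the weaker bound [N / (4 q^4)] is the square of [t], which avoids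
   half-integer powers of [q]. *)
pose t := S / (2 * q ^+ 2).
have q2 : 0 < 2 * q ^+ 2 by rewrite mulr_gt0// exprn_gt0.
have t0 : 0 < t by rewrite divr_gt0.
have qq : q ^+ 3 <= q ^+ 4 by rewrite ler_weXn2l.
have q3 : 0 < q ^+ 3 by rewrite exprn_gt0.
have hD2 : t ^+ 2 <= D.
  apply: le_trans hD; have h : N / 2 <= N - 1 by lra.
  apply: le_trans (ler_wpM2r (ltW m0) h).
  rewrite NS (_ : t ^+ 2 = S ^+ 2 / 2 * (2 * q ^+ 4)^-1); last first.
    by rewrite /t; field; rewrite gt_eqF.
  apply: ler_wpM2l; first by rewrite divr_ge0// sqr_ge0.
  by rewrite /m lef_pV2 ?posrE//; lra.
have k1 : 1 <= t.
  by rewrite ler_pdivlMr// mul1r; have := @hS 2%N isT; lra.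
have D1 : 1 <= D by apply: le_trans hD2; rewrite expr_ge1// ltW.
have D0 : 0 < D by exact: lt_le_trans D1.
split => //.
- have -> : 2 * (q ^+ 2 / S) = t^-1 by rewrite /t; field; rewrite !gt_eqF.
  rewrite lef_pV2 ?posrE ?sqrtr_gt0//.
  have {1}-> : t = Num.sqrt (t ^+ 2) by rewrite sqrtr_sqr ger0_norm// ltW.
  exact: ler_wsqrtr.
- move=> r; rewrite [4 * _]mulrC -mulrA; apply: ler_wpM2l => //.
  apply: (@le_trans _ _ (t ^+ 2)^-1).
    by rewrite lef_pV2// posrE exprn_gt0.
  have -> : (t ^+ 2)^-1 = 4 * (q ^+ 4 / S / S) by rewrite /t; field; rewrite !gt_eqF.
  rewrite ler_pM2l// ler_pM2r ?invr_gt0//.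
  rewrite ler_pdivrMr//; apply: (@le_trans _ _ (q ^+ 20)).
    exact: expr_le20 q1 _.
  by apply: ler_peMr; [apply: exprn_ge0; exact: ltW|lra].
Qed.

Lemma rate_small : [/\ q / N <= 4^-1, 2 / ((N - 1) * m) <= 2^-1,
  4 / N <= q ^+ 20 / S & 16 * (q ^+ 7 / S) < 1].
Proof.
have hS20 : 20 <= S := S20.
have N4 := rate_N_ge; have N0 : 0 < N by lra.
have Sq := @hS 1%N isT; rewrite expr1 in Sq.
have Sq3 := @hS 3%N isT.
have Sq7 := @hS 7%N isT.
split.
- by rewrite ler_pdivrMr//; lra.
- have N1 : 0 < (N - 1) * m by rewrite mulr_gt0//; lra.
  rewrite ler_pdivrMr// /m mulrA ler_pdivlMr ?exprn_gt0//; lra.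
- rewrite NS expr2 invfM mulrA ler_pM2r ?invr_gt0// ler_pdivrMr//.
  have : 1 <= q ^+ 20 by rewrite exprn_ege1.
  by move=> h; nra.
- by rewrite mulrA ltr_pdivrMr// mul1r; have := exprn_gt0 7 q0; lra.
Qed.

End rate.

(** All size-dependent errors of [rescaled_error_cvg] are measured by the single rate [w]; the
    smoothing parameters [eta], [delta], [e1] remain free, to be fixed before the size grows. *)
Lemma rescaled_error_rate (R : realType) (r s : nat) (b : 'cV[R]_(r + s)) d
    (T : measurableType d) (P : probability T R) (adj : T -> rel 'I_(r + s))
    (bhat : T -> 'cV[R]_(r + s)) (eta delta e1 : R) (x : 'I_r -> R) :
  let q := ln (r + s)%:R in let w := q ^+ 20 / Num.sqrt (r + s)%:R in
  let tau := (2 * 2116 + 2 * r%:R) * w in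
  beta_model P b adj -> is_mle adj bhat -> (1 <= r)%N ->
  4 * expR 2 <= q -> max_abs b <= ln q -> w <= 20^-1 -> 4 * r%:R * w <= eta ->
  0 < eta -> 0 < delta -> 0 <= e1 ->
  1 - e1 <= normal_cdf (delta * inv_sqrt (2 * eta)) ->
  normal_cdf (- delta * inv_sqrt (2 * eta)) <= e1 ->
  `|fine (P [set w | forall j,
        usubmx (sqrt_diag_fisher b *m (bhat w - b)) j 0 <= x j]) -
    \prod_j normal_cdf (x j)| <=
  w + (9 * \sum_j ((`|x j| + tau) * eta + delta + tau) + r.+1%:R * e1 +
    smoothing_constant eta * (8 * r%:R * w)).
Proof.
move=> q w tau hmodel hmle r1 hq Kq w20 rw eta0 delta0 e10 Phi1 Phi0.
set N : R := (r + s)%:R; pose S := Num.sqrt N.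
have q1 : 1 <= q.
  have : 1 <= expR 2 :> R by rewrite leNgt expR_lt1 -leNgt.
  by lra.
have q0 : 0 < q by lra.
have N0 : 0 < N.
  rewrite lt_neqAle ler0n andbT; apply: contraTneq q0.
  by rewrite /q -/N => <-; rewrite ln0 ?ltxx.
have S0 : 0 < S by rewrite sqrtr_gt0.
have NS : N = S ^+ 2 by rewrite sqr_sqrtr// ltW.
have hS k : (k <= 20)%N -> 20 * q ^+ k <= S.
  move=> k20; move: w20; rewrite ler_pdivrMr// -/S.
  by have := expr_le20 q1 k20; move: (q ^+ 20) (q ^+ k) => a c; lra.
have N20 := rate_N_ge hS NS.
have S20 := @hS 0%N isT; rewrite expr0 mulr1 in S20.
have [small1 small2 small3 small4] := rate_small q1 hS NS.
set m : R := (q ^+ 3)^-1 in small2.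
have m0 : 0 < m by rewrite invr_gt0 exprn_gt0.
have m01 : 0 < m <= 1.
  by rewrite m0 invf_le1 ?exprn_gt0// exprn_ege1.
have bK i : `|b i 0| <= max_abs b.
  by rewrite /max_abs; exact: (le_bigmax _ (fun i => `|b i 0|) i).
have mv u : `|u| <= 2 * max_abs b + 2 -> m <= logistic_var u.
  exact: logistic_var_ge_log.
have mb i j : m <= logistic_var (b i 0 + b j 0).
  apply: mv; rewrite (le_trans (ler_normD _ _))//.
  by have := bK i; have := bK j; lra.
have n400 : 400 <= N by nra.
have n2 : (2 < r + s)%N.
  by rewrite -(ltr_nat R) -/N; lra.
pose G : R := 4 * Num.sqrt (N * q).
pose H : R := 2 * q + 32 / m ^+ 2.
have G0 : 0 <= G by rewrite mulr_ge0// sqrtr_ge0.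
have H0 : 0 <= H by rewrite addr_ge0 ?divr_ge0 ?exprn_ge0 ?mulr_ge0// ltW.
have hG := rate_G q1 hS NS; rewrite -/m -/G in hG.
have rho0 : 0 <= 2 * G / ((N - 2) * m ^+ 2).
  by rewrite divr_ge0 ?mulr_ge0 ?exprn_ge0 ?(ltW m0)//; lra.
have htau := rate_tau q1 hS NS rho0 hG; rewrite -/m -/H in htau.
have kap i : (N - 1) * m <= fisher_diag (fun i => b i 0) i by exact: fisher_diag_ge.
have kap' j := rate_kappa q1 hS NS (kap (lshift s j)).
have w0 : 0 < w by rewrite divr_gt0// exprn_gt0.
pose kappa := 2 * (q ^+ 2 / S).
have q2 : q ^+ 2 / S <= w by rewrite ler_pM2r ?invr_gt0//; exact: expr_le20 q1 _.
have Ebad : Ex (edge_p (fun i => b i 0)) edges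
    (fun h => (bad (fun i => b i 0) G H h)%:R) (fun=> false) <= w.
  apply: (le_trans _ small3); apply: Ex_bad => //; exact: ltnW.
have main := @rescaled_error_cvg R r s b d T P adj hmodel bhat hmle m (max_abs b) G H
  kappa tau eta delta e1 w x r1 n2 m01 G0 H0 bK mv _ Ebad _ _ _ _ eta0 delta0 e10
  Phi1 Phi0.
apply: (le_trans (main _ _ _ _ _)).
- exact: le_lt_trans hG small4.
- by move=> j; case: (kap' j).
- by move=> j; case: (kap' j).
- by move=> j; apply: le_trans rw; case: (kap' j) => _ _; apply.
- rewrite /tau [leRHS]mulrDl; apply: lerD; first exact: htau.
  rewrite (_ : r%:R * kappa = 2 * r%:R * (q ^+ 2 / S)); last by rewrite /kappa; ring.
  by apply: ler_wpM2l q2; rewrite mulr_ge0.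
rewrite lerD2l lerD2l; apply: ler_wpM2l.
  apply: addr_ge0; apply: mulr_ge0 => //; apply: exprn_ge0;
  by rewrite ltW// inv_sqrt_gt0.
have -> : N * (r%:R * kappa ^+ 3) = 8 * r%:R * (q ^+ 6 / S).
  by rewrite NS /kappa; field; rewrite gt_eqF.
apply: ler_wpM2l; first by rewrite mulr_ge0.
by rewrite ler_pM2r ?invr_gt0//; exact: expr_le20 q1 _.
Qed.

(** * Convergence in distribution *)

Lemma std_normal_cdf (R : realType) r (x : 'rV[R]_r) :
  joint_cdf (std_normal r) x = (\prod_j normal_cdf (x 0 j))%:E.
Proof.
rewrite -prodEFin; under eq_bigr do rewrite normal_cdfE.
rewrite -std_normal_box// /joint_cdf; congr (std_normal r _).
Qed.

(* The part of the error bound of rescaled_error_rate that does not vanish with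
   its rate w can be made at most eps / 2. *)
Lemma smoothing_parameters (R : realType) (r : nat) (B eps : R) : 0 <= B -> 0 < eps ->
  exists eta delta e1, [/\ 0 < eta, 0 < delta, 0 <= e1,
    1 - e1 <= normal_cdf (delta * inv_sqrt (2 * eta)) /\
    normal_cdf (- delta * inv_sqrt (2 * eta)) <= e1 &
    9 * (B * eta + r%:R * delta) + r.+1%:R * e1 <= eps / 2].
Proof.
move=> B0 eps0.
(* The terms in [eta], [delta] and [e1] will each contribute at most [eps / 8]. *)
pose e1 : R := eps / (8 * r.+1%:R).
pose delta : R := eps / (72 * r.+1%:R).
have e10 : 0 < e1 by rewrite divr_gt0// mulr_gt0.
have d0 : 0 < delta by rewrite divr_gt0// mulr_gt0.
have [M1 hM1] := normal_cdf_cvgy e10.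
have [M2 hM2] := normal_cdf_cvgNy e10.
pose M : R := Num.max 1 (Num.max M1 (- M2)).
have M11 : 1 <= M by rewrite le_max lexx.
have M12 : M1 <= M by rewrite !le_max lexx orbT.
have M13 : - M2 <= M by rewrite !le_max lexx !orbT.
have M0 : 0 < M by lra.
(* The first bound makes [delta / sqrt (2 eta)] at least [M], beyond which both normal tails are
   below [e1]. *)
pose eta := Num.min ((delta / M) ^+ 2 / 2) (eps / (72 * (B + 1))).
have dM : 0 < delta / M by rewrite divr_gt0.
have B1 : 0 < B + 1 by rewrite ltr_wpDl.
have eta0 : 0 < eta.
  have h1 : 0 < (delta / M) ^+ 2 / 2 by rewrite divr_gt0// exprn_gt0.
  have h2 : 0 < eps / (72 * (B + 1)) by rewrite divr_gt0// mulr_gt0.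
  by rewrite lt_min h1.
have k : M <= delta * inv_sqrt (2 * eta).
  have h : 2 * eta <= (delta / M) ^+ 2.
    have : eta <= (delta / M) ^+ 2 / 2 by rewrite ge_min lexx.
    by lra.
  have : inv_sqrt ((delta / M) ^+ 2) <= inv_sqrt (2 * eta).
    by rewrite inv_sqrt_le// mulr_gt0.
  rewrite /inv_sqrt sqrtr_sqr gtr0_norm// invf_div => h2.
  by rewrite mulrC -ler_pdivrMr.
exists eta, delta, e1; split; [by []|by []|exact: ltW| |].
  split; first by apply: hM1; exact: le_trans M12 k.
  by apply: hM2; rewrite mulNr; lra.
have h1 : B * eta <= eps / 72.
  have : eta <= eps / (72 * (B + 1)) by rewrite ge_min lexx orbT.
  rewrite ler_pdivlMr; last by lra.
  by rewrite ler_pdivlMr//; nra.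
have r0 : 0 < r.+1%:R :> R by [].
have h2 : r%:R * delta <= eps / 72.
  have -> : r%:R * delta = eps / 72 * (r%:R / r.+1%:R).
    by rewrite /delta; field; rewrite gt_eqF.
  apply: ler_piMr; first by rewrite divr_ge0// ltW.
  by rewrite ler_pdivrMr// mul1r ler_nat.
have h3 : r.+1%:R * e1 = eps / 8 by rewrite /e1; field; rewrite gt_eqF.
by rewrite h3; lra.
Qed.

(* Sizes t >= r are written t = r + s, so that the first r entries of a column
   vector of size t are given by usubmx. *)
Theorem theorem2 (R : realType) (beta : forall t : nat, 'cV[R]_t)
    (d : nat -> measure_display) (T : forall t : nat, measurableType (d t))
    (P : forall t : nat, probability (T t) R)
    (adj : forall t : nat, T t -> rel 'I_t)
    (betahat : forall t : nat, T t -> 'cV[R]_t)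
    (hmodel : forall t : nat, beta_model (P t) (beta t) (adj t))
    (hmle : forall t : nat, is_mle (adj t) (betahat t))
    (hL : (fun t : nat => max_abs (beta t) : R^o) =o_\oo
          (fun t : nat => ln (ln t%:R) : R^o))
    (r : nat) (hr : (1 <= r)%N) :
  cvg_in_distribution (fun s : nat => P (r + s)%N)
    (fun (s : nat) (w : T (r + s)%N) =>
       [tuple usubmx (sqrt_diag_fisher (beta (r + s)%N) *m
                        (betahat (r + s)%N w - beta (r + s)%N)) i 0 | i < r])
    (std_normal r).
Proof.
move=> x _; rewrite std_normal_cdf.
have cdfE s : joint_cdf (pushforward (P (r + s)%N) (fun w : T (r + s)%N =>
      [tuple usubmx (sqrt_diag_fisher (beta (r + s)%N) *m
        (betahat (r + s)%N w - beta (r + s)%N)) i 0 | i < r])) x =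
    P (r + s)%N [set w | forall j, usubmx (sqrt_diag_fisher (beta (r + s)%N) *m
        (betahat (r + s)%N w - beta (r + s)%N)) j 0 <= x 0 j].
  rewrite /joint_cdf /pushforward; congr (P _ _).
  by apply/seteqP; split => w /= h j; have := h j; rewrite tnth_mktuple.
under eq_fun do rewrite cdfE.
apply: cvg_EFin.
  apply: nearW => s; rewrite fin_num_measure//.
  exact: (measurable_rescaled_error (beta (r + s)%N) (hmle (r + s)%N) (fun j => x 0 j)).
apply/cvgrPdist_le => eps eps0.
pose B : R := \sum_j `|x 0 j|.
have B0 : 0 <= B by exact: sumr_ge0.
have [eta [delta [e1 [eta0 delta0 e10 [Phi1 Phi0] heps]]]] :=
  @smoothing_parameters R r B eps B0 eps0.
pose c : R := 2 * 2116 + 2 * r%:R.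
(* The total coefficient of [w] in [rescaled_error_rate], where [tau = c * w]. *)
pose C : R := 1 + 9 * (r%:R * c * (eta + 1)) + smoothing_constant eta * (8 * r%:R).
have c0 : 0 <= c by apply: addr_ge0; apply: mulr_ge0; exact: ler0n.
have sc0 : 0 <= smoothing_constant eta.
  apply: addr_ge0; apply: mulr_ge0 => //; apply: exprn_ge0;
  by rewrite ltW// inv_sqrt_gt0.
have C1 : 1 <= C.
  rewrite /C -addrA lerDl; apply: addr_ge0; last by rewrite !mulr_ge0.
  apply: mulr_ge0 => //; apply: mulr_ge0; first exact: mulr_ge0.
  by rewrite addr_ge0// ltW.
have C0 : 0 < C by lra.
(* The first two bounds are requirements of [rescaled_error_rate]; the third leaves at most
   [eps / 2] for the terms in [w]. *)
pose w0 : R := Num.min 20^-1 (Num.min (eta / (4 * r%:R)) (eps / 2 / C)).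
have r0 : 0 < r%:R :> R by rewrite ltr0n.
have w00 : 0 < w0.
  have h1 : 0 < eta / (4 * r%:R) by rewrite divr_gt0// mulr_gt0.
  have h2 : 0 < eps / 2 / C by rewrite !divr_gt0.
  by rewrite !lt_min h1 h2 !andbT invr_gt0 ltr0n.
have [N1 hN1] := @ln_exp_sqrt_small R 20%N w0 w00.
have [N2 hN2] := @ln_nat_ge R (4 * expR 2).
(* The little-o with constant 1 bounds [max_abs (beta t)] by [|ln (ln t)|] from [N3] on. *)
move/eqoP : hL => /(_ 1 ltr01) [N3 _ hN3].
exists (N1 + N2 + N3)%N => // s /= Ns.
have rs : (N1 + N2 + N3 <= r + s)%N := leq_trans Ns (leq_addl r s).
have ge1 : (N1 <= r + s)%N by rewrite (leq_trans _ rs)// -addnA leq_addr.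
have ge2 : (N2 <= r + s)%N by rewrite (leq_trans _ rs)// addnAC leq_addl.
have ge3 : (N3 <= r + s)%N by rewrite (leq_trans _ rs)// leq_addl.
have hq := hN2 _ ge2; have hw := hN1 _ ge1; have hK := hN3 _ ge3.
have e2 : 1 <= expR 2 :> R by rewrite leNgt expR_lt1 -leNgt.
set q : R := ln (r + s)%:R in hq hw hK.
set w := q ^+ 20 / _ in hw.
have lnq0 : 0 <= ln q by apply: ln_ge0; lra.
have Kq : max_abs (beta (r + s)%N) <= ln q.
  apply: le_trans (ler_norm _) _.
  by move: hK; rewrite /= mul1r [X in _ <= X]ger0_norm.
have w1 : w <= 20^-1 by apply: (le_trans hw); rewrite ge_min lexx.
have w2 : 4 * r%:R * w <= eta.
  rewrite mulrC -ler_pdivlMr ?mulr_gt0//; apply: (le_trans hw).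
  by rewrite !ge_min lexx orbT.
have w3 : C * w <= eps / 2.
  rewrite mulrC -ler_pdivlMr//; apply: (le_trans hw).
  by rewrite !ge_min lexx !orbT.
have main := rescaled_error_rate (fun j => x 0 j) (hmodel (r + s)%N) (hmle (r + s)%N)
  hr hq Kq w1 w2 eta0 delta0 e10 Phi1 Phi0.
rewrite distrC; apply: (le_trans main); rewrite -/q -/w -/c.
have -> : \sum_j ((`|x 0 j| + c * w) * eta + delta + c * w) =
    B * eta + r%:R * delta + r%:R * c * (eta + 1) * w.
  have cst (y : R) : \sum_(j < r) y = r%:R * y.
    by rewrite sumr_const card_ord mulr_natl.
  rewrite !big_split/= -mulr_suml big_split/= !cst -/B; ring.
move: w3 heps; rewrite /C; set a1 := B * eta; set a2 := r%:R * delta.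
set a3 := r.+1%:R * e1; set a4 := smoothing_constant eta * _.
have -> : smoothing_constant eta * (8 * r%:R * w) = a4 * w by rewrite /a4; ring.
by set a5 := r%:R * c * (eta + 1); lra.
Qed.
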